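(* Let $m,n\ge 1$ be integers and let $\mathcal A\in\mathbb R^{m\times n\times m\times n}$ be a partially symmetric Gaussian random tensor. Then $$\mathbb E\,\rho_m(\mathcal A)\le 2\sqrt m+2\sqrt n.$$
   Context: A tensor $\mathcal A\in\mathbb R^{m\times n\times m\times n}$ is partially symmetric if $\mathcal A_{ijkl}=\mathcal A_{kjil}=\mathcal A_{ilkj}=\mathcal A_{klij}$ for all $1\le i,k\le m$, $1\le j,l\le n$. For an index tuple $(i,j,k,l)$ let $\Pi(i,j,k,l)=\{(i,j,k,l),(k,j,i,l),(i,l,k,j),(k,l,i,j)\}$, regarded as a set of distinct tuples, and let $\mathrm{card}(\cdot)$ denote cardinality. A partially symmetric Gaussian random tensor is defined as follows: the entries $\mathcal A_{ijkl}$ with $i\le k$ and $j\le l$ are independent with $$\mathcal A_{ijkl}\sim N\left(0,\frac{2}{\mathrm{card}(\Pi(i,j,k,l))}\right)$$ (mean $0$ and the indicated variance), and the other entries are determined by partial symmetry, i.e. entries whose index tuples lie in the same set $\Pi(i,j,k,l)$ are equal. For example, $\mathcal A_{1111}\sim N(0,2)$, $\mathcal A_{1212}\sim N(0,2)$, $\mathcal A_{3212}=\mathcal A_{1232}\sim N(0,1)$, $\mathcal A_{2312}=\mathcal A_{2213}=\mathcal A_{1322}=\mathcal A_{1223}\sim N(0,\tfrac12)$. With $\|\cdot\|$ the Euclidean norm, the largest M-eigenvalue of $\mathcal A$ is (the subscript in $\rho_m$ is only a label, unrelated to the dimension $m$) $$\rho_m(\mathcal A)=\max\left\{\sum_{i,k=1}^m\sum_{j,l=1}^n\mathcal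 A_{ijkl}\mathbf u_i\mathbf v_j\mathbf u_k\mathbf v_l:\ \mathbf u\in\mathbb R^m,\ \mathbf v\in\mathbb R^n,\ \|\mathbf u\|=\|\mathbf v\|=1\right\}.$$ *)

(* Defs.v *)
From HB Require Import structures.
From mathcomp Require Import all_boot all_order all_algebra.
From mathcomp Require Import all_classical all_reals all_analysis.

Set Implicit Arguments.
Unset Strict Implicit.
Unset Printing Implicit Defensive.

Import Order.TTheory GRing.Theory Num.Theory.
Import numFieldNormedType.Exports.

Local Open Scope classical_set_scope.
Local Open Scope ring_scope.

Definition tensor_index (m n : nat) : finType := ('I_m * 'I_n * 'I_m * 'I_n)%type.

Definition tensor (R : Type) (m n : nat) := 'I_m -> 'I_n -> 'I_m -> 'I_n -> R.

Definition partially_symmetric (R : Type) (m n : nat) (A : tensor R m n) : Prop :=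
  forall (i k : 'I_m) (j l : 'I_n),
    [/\ A i j k l = A k j i l, A i j k l = A i l k j & A i j k l = A k l i j].

Definition Pi_class (m n : nat) (i : 'I_m) (j : 'I_n) (k : 'I_m) (l : 'I_n) :
    {set tensor_index m n} :=
  [set (i, j, k, l); (k, j, i, l); (i, l, k, j); (k, l, i, j)]%SET.

(* The indices of the entries that are chosen freely. *)
Definition free_index (m n : nat) : {set tensor_index m n} :=
  [set t : tensor_index m n | let: (i, j, k, l) := t in (i <= k)%N && (j <= l)%N]%SET.

(* Mutual independence of the subfamily of X indexed by D. *)
Definition mutually_independent (d : measure_display) (T : measurableType d)
    (R : realType) (P : probability T R) (I : finType) (D : {set I})
    (X : I -> {RV P >-> R}) : Prop :=
  forall J : {set I}, J \subset D ->
  forall B : I -> set R, (forall i, measurable (B i)) ->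
    P (\bigcap_(i in [set` J]) X i @^-1` B i) =
    (\prod_(i in J) P (X i @^-1` B i))%E.

(* Note that normal_prob takes the standard deviation, not the variance. *)
Definition normally_distributed (d : measure_display) (T : measurableType d)
    (R : realType) (P : probability T R) (mean variance : R)
    (X : {RV P >-> R}) : Prop :=
  forall V : set R, measurable V ->
    distribution P X V = normal_prob mean (Num.sqrt variance) V.

Record gaussian_random_tensor (d : measure_display) (T : measurableType d)
    (R : realType) (P : probability T R) (m n : nat)
    (A : tensor {RV P >-> R} m n) : Prop := {
  gaussian_independent :
    mutually_independent (free_index m n)
      (fun t : tensor_index m n => let: (i, j, k, l) := t in A i j k l);
  gaussian_law : forall (i k : 'I_m) (j l : 'I_n), (i <= k)%N -> (j <= l)%N ->
    normally_distributed 0 (2 / #|Pi_class i j k l|%:R) (A i j k l);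
  gaussian_symmetric :
    forall w : T, partially_symmetric (fun i j k l => A i j k l w) }.

(* The library's norm `|u| on 'rV[R]_p is the sup norm. *)
Definition enorm (R : realType) (p : nat) (u : 'rV[R]_p) : R :=
  Num.sqrt (\sum_i u ord0 i ^+ 2).

Definition biquadratic (R : realType) (m n : nat) (A : tensor R m n)
    (u : 'rV[R]_m) (v : 'rV[R]_n) : R :=
  \sum_(i < m) \sum_(k < m) \sum_(j < n) \sum_(l < n)
    A i j k l * u ord0 i * v ord0 j * u ord0 k * v ord0 l.

Definition rho_values (R : realType) (m n : nat) (A : tensor R m n) : set R :=
  [set x | exists u : 'rV[R]_m, exists v : 'rV[R]_n,
     [/\ enorm u = 1, enorm v = 1 & x = biquadratic A u v]].

(* For m, n >= 1 this supremum is a maximum, see rho_m_max below. *)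
Definition rho_m (R : realType) (m n : nat) (A : tensor R m n) : R :=
  sup (rho_values A).

Lemma enorm_continuous (R : realType) (p : nat) : continuous (@enorm R p).
Proof.
move=> u; rewrite /enorm.
apply: (@continuous_comp _ _ _
  (fun u : 'rV[R]_p => \sum_i u ord0 i ^+ 2) Num.sqrt); last exact: sqrt_continuous.
move: u; apply: continuous_big => [|i _ u]; first exact: add_continuous.
apply: (@continuous_comp _ _ _ (fun u : 'rV[R]_p => u ord0 i) (fun x => x ^+ 2)).
  exact: coord_continuous.
exact: exprn_continuous.
Qed.

Lemma compact_sphere (R : realType) (p : nat) :
  compact [set u : 'rV[R]_p | enorm u = 1].
Proof.
have cube : compact [set u : 'rV[R]_p | forall i, [set` `[(-1 : R), 1]] (u ord0 i)].
  apply: (@rV_compact _ _ (fun=> [set` `[(-1 : R), 1]])) => _.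
  exact: segment_compact.
apply: (subclosed_compact _ cube).
  have /continuous_closedP := @enorm_continuous R p.
  by move=> /(_ _ (@closed_eq R 1)).
move=> u /= u1 i; rewrite /= in_itv /= -ler_norml -u1 /enorm -sqrtr_sqr.
rewrite ler_wsqrtr// (bigD1 i)//= lerDl.
by apply: sumr_ge0 => j _; exact: sqr_ge0.
Qed.

Lemma sphere_nonempty (R : realType) (p : nat) :
  (0 < p)%N -> [set u : 'rV[R]_p | enorm u = 1] !=set0.
Proof.
case: p => // p _; exists (delta_mx ord0 ord0); rewrite /= /enorm.
rewrite (bigD1 ord0)//= big1 => [|i i0]; rewrite mxE/= ?(negbTE i0) ?expr0n//=.
by rewrite expr1n addr0 sqrtr1.
Qed.

Lemma biquadratic_continuous (R : realType) (m n : nat) (A : tensor R m n) :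
  continuous (fun w : 'rV[R]_m * 'rV[R]_n => biquadratic A w.1 w.2).
Proof.
have c1 i : continuous (fun w : 'rV[R]_m * 'rV[R]_n => w.1 ord0 i).
  move=> w; apply: (@continuous_comp _ _ _ fst (fun u : 'rV[R]_m => u ord0 i)).
    exact: cvg_fst.
  exact: coord_continuous.
have c2 i : continuous (fun w : 'rV[R]_m * 'rV[R]_n => w.2 ord0 i).
  move=> w; apply: (@continuous_comp _ _ _ snd (fun u : 'rV[R]_n => u ord0 i)).
    exact: cvg_snd.
  exact: coord_continuous.
do 4 (apply: continuous_big => [|? _]; first exact: add_continuous).
move=> w; apply: cvgM; last exact: c2.
apply: cvgM; last exact: c1.
apply: cvgM; last exact: c2.
by apply: cvgM; [exact: cvg_cst | exact: c1].
Qed.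

Lemma rho_m_max (R : realType) (m n : nat) (A : tensor R m n) :
  (0 < m)%N -> (0 < n)%N -> rho_values A (rho_m A) /\ ubound (rho_values A) (rho_m A).
Proof.
move=> m0 n0.
have [u0 u0P] := @sphere_nonempty R m m0; have [v0 v0P] := @sphere_nonempty R n n0.
have [||| [u v] /set_mem [/= u1 v1] uvmax] := @compact_EVT_max _ R
    (fun w : 'rV[R]_m * 'rV[R]_n => biquadratic A w.1 w.2)
    ([set u : 'rV[R]_m | enorm u = 1] `*` [set v : 'rV[R]_n | enorm v = 1]).
- by exists (u0, v0).
- by apply: compact_setX; exact: compact_sphere.
- by apply: continuous_subspaceT; exact: biquadratic_continuous.
have max_ub : ubound (rho_values A) (biquadratic A u v).
  by move=> _ [a [b [a1 b1 ->]]]; apply: (uvmax (a, b)); exact/mem_set.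
have val : rho_values A (biquadratic A u v) by exists u, v.
suff -> : rho_m A = biquadratic A u v by [].
apply/eqP; rewrite eq_le; apply/andP; split.
  by apply: ge_sup => //; exists (biquadratic A u v).
by apply: ub_le_sup => //; exists (biquadratic A u v).
Qed.

(* Main.v *)
(** Write [X(u,v)] for the biquadratic form. Each class contributes variance
    [2 card (u_i v_j u_k v_l)^2], so [E (X(u,v) - X(u',v'))^2 = 4 (1 - s^2 t^2)] with
    [s = u.u'] and [t = v.v'], and this is at most [8 (1 - s) + 8 (1 - t)], the variance
    of the increment of [Y(u,v) = 2 g.u + 2 h.v] for independent standard normal [g], [h].
    By Sudakov-Fernique, [E max X <= E max Y <= 2 E |g| + 2 E |h|] on every finite set of
    points, and a fine net of the product of the spheres gives the claim.

    The Sudakov-Fernique inequality is proved for the log-sum-exp function by Lindeberg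
    replacement: a Gaussian vector is a sum of [2^k] independent copies scaled by
    [2^(-k/2)], and exchanging one copy of [X] for one of [Y] changes the expectation of
    log-sum-exp, up to an error of order [2^(-3k/2)], by a nonnegative multiple of the
    averaged difference of the increment variances. *)

Require Import Defs.
From HB Require Import structures.
From mathcomp Require Import all_boot all_order all_algebra.
From mathcomp Require Import all_classical all_reals all_analysis.
From mathcomp Require Import measurable_realfun.
From mathcomp Require Import ring lra.

Import Order.TTheory GRing.Theory Num.Theory.
Import numFieldNormedType.Exports.

Local Open Scope classical_set_scope.
Local Open Scope ring_scope.

(** * The standard normal law *)

(** The comparison is carried out on iterated one-dimensional Gaussian integrals of Lipschitz
    functions instead of random vectors. Averaging preserves a Lipschitz constant, and this constant
    together with a first moment secures every integrability condition; the independent copies of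
    the replacement argument become further averages, and exchanging copies amounts to commuting
    averages. [Rintegral_avgs] ties these integrals to the given probability space.

    Log-sum-exp replaces the maximum because it is smooth, at a cost of the logarithm of the number
    of points. Scaling the form by a large beta and dividing by beta afterwards makes this cost
    negligible; the net is fixed before beta is chosen.

    The factor 2 in Y is the least possible: for t = 1 the increment variance 4 (1 - s^2) behaves
    like 8 (1 - s) as s tends to 1. *)

Lemma ge0_integral_normal_prob (R : realType) (m s : R) {f : R -> \bar R} :
  measurable_fun [set: R] f -> (forall x, 0 <= f x)%E ->
  (\int[normal_prob m s]_x f x =
   \int[lebesgue_measure]_x (f x * (normal_pdf m s x)%:E))%E.
Proof.
move=> mf f0.
have dom := normal_prob_dominates m s.
rewrite -(@Radon_Nikodym_SigmaFinite.change_of_variables _ _ _ (normal_prob m s) lebesgue_measure dom f)//.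
have mpdf := @measurable_normal_pdf R m s.
have intRN := Radon_Nikodym_SigmaFinite.f_integrable dom.
apply: ae_eq_integral => //.
- by apply: emeasurable_funM => //; exact: measurable_int intRN.
- by apply: emeasurable_funM => //; exact/measurable_EFinP.
(* The Radon-Nikodym derivative and [normal_pdf] have equal integrals over every measurable set,
   hence agree almost everywhere. *)
- apply: ae_eqe_mul2l => /=.
  apply: integral_ae_eq => //=.
    exact/measurable_EFinP.
  by move=> E _ mE; rewrite -Radon_Nikodym_SigmaFinite.f_integral.
Qed.

Lemma ge0_integral_normal_prob_EFin {R : realType} {m s : R} {f : R -> R} :
  measurable_fun [set: R] f -> (forall x, 0 <= f x) ->
  (\int[normal_prob m s]_x (f x)%:E =
   \int[lebesgue_measure]_x (f x * normal_pdf m s x)%:E)%E.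
Proof.
move=> mf f0; rewrite (@ge0_integral_normal_prob R) => [|//|x]; last by rewrite lee_fin.
  by apply: eq_integral => x _; rewrite EFinM.
exact/measurable_EFinP.
Qed.

Lemma integral_normal_prob_affine (R : realType) (m s : R) (g : R -> R) :
  0 < s -> continuous g -> (forall x, 0 <= g x) ->
  (\int[normal_prob m s]_x (g x)%:E =
   \int[normal_prob 0 1]_x (g (m + s * x)%R)%:E)%E.
Proof.
move=> s0 cg g0.
have mg : measurable_fun [set: R] g by exact: continuous_measurable_fun.
have caff : continuous (fun x : R => m + s * x).
  move=> x; apply: cvgD; first exact: cvg_cst.
  by apply: cvgM; [exact: cvg_cst|exact: cvg_id].
have isd (x : R) : is_derive x 1 (fun x : R => m + s * x) s.
  by apply: is_derive_eq; rewrite add0r mul1r /GRing.scale /= mulr1.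
have dF : (fun x : R => m + s * x)^`()%classic = cst s.
  by apply/funext => x; rewrite derive1E derive_val.
have mgF : measurable_fun [set: R] (fun x => g (m + s * x)).
  apply: continuous_measurable_fun => x.
  by apply: (continuous_comp (caff x)); exact: cg.
rewrite (ge0_integral_normal_prob_EFin mg g0).
rewrite (ge0_integral_normal_prob_EFin mgF (fun x => g0 _)).
rewrite (@increasing_ge0_integration_by_substitutionT _ (fun x : R => m + s * x)).
- apply: eq_integral => x _; rewrite dF /=; congr EFin.
  change (g (m + s * x) * normal_pdf m s (m + s * x) * s = g (m + s * x) * normal_pdf 0 1 x).
  rewrite -mulrA; congr (_ * _).
  rewrite !normal_pdfE ?oner_eq0 ?gt_eqF//.
  rewrite /normal_peak /normal_fun.
  have -> : - (m + s * x - m) ^+ 2 / (s ^+ 2 *+ 2) = - (x - 0) ^+ 2 / (1 ^+ 2 *+ 2).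
    rewrite [m + _]addrC addrK subr0 expr1n exprMn -(mulr_natr (s ^+ 2)) -mulrN invfM.
    by rewrite mulrACA divff ?mul1r// expf_neq0// gt_eqF.
  rewrite -!mulrnAr sqrtrM ?sqr_ge0// sqrtr_sqr gtr0_norm// expr1n mul1r invfM.
  by rewrite [LHS]mulrC !mulrA divff ?gt_eqF// !mul1r.
- by move=> x y xy; rewrite ltrD2l ltr_pM2l.
- by rewrite dF => ?; exact: cvg_cst.
- by rewrite dF; exact: is_cvg_cst.
- by rewrite dF; exact: is_cvg_cst.
- by move=> x; apply: ex_derive.
- apply: cvg_comp; last exact: (cvg_addrl_Ny m).
  by apply/gt0_cvgMrNy => //; exact: cvg_id.
- apply: cvg_comp; last exact: (cvg_addrl m).
  by apply/gt0_cvgMry => //; exact: cvg_id.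
- by move=> x; apply: cvgM; [exact: cg|apply: continuous_normal_pdf; rewrite gt_eqF].
- by move=> x; rewrite mulr_ge0// normal_pdf_ge0.
Qed.

(* Completing the square in the exponents. *)
Lemma normal_pdf_conv (R : realType) (a b x u : R) : 0 < a -> 0 < b ->
  a ^+ 2 + b ^+ 2 = 1 ->
  normal_pdf (a * x) b u * normal_pdf 0 1 x =
  normal_pdf 0 1 u * normal_pdf (a * u) b x.
Proof.
move=> a0 b0 ab; rewrite !normal_pdfE ?oner_eq0 ?gt_eqF//.
rewrite /normal_fun mulrACA [RHS]mulrACA -!expRD.
rewrite [normal_peak 1 * _]mulrC; congr (_ * expR _).
rewrite !subr0 expr1n -!(mulr_natr (b ^+ 2)).
have b2 : 1 - a ^+ 2 = b ^+ 2 by rewrite -ab; ring.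
apply: (@mulIf _ (b ^+ 2 * 2)); first by rewrite mulf_neq0 ?expf_neq0 ?gt_eqF.
rewrite !mulrDl !mulfVK ?mulf_neq0 ?expf_neq0 ?gt_eqF//.
have e (y : R) : - y ^+ 2 / 2 * (b ^+ 2 * 2) = - y ^+ 2 * b ^+ 2 by field.
by rewrite !e -b2; ring.
Qed.

(** Substituting u = a x + b y in the inner integral and exchanging by Tonelli isolates u; by
    [normal_pdf_conv] what remains in x is a normal density with mean a u, of mass 1. *)
Lemma integral_normal_prob_stable (R : realType) (a b : R) (g : R -> R) :
  0 < a -> 0 < b -> a ^+ 2 + b ^+ 2 = 1 ->
  continuous g -> (forall x, 0 <= g x) ->
  (\int[normal_prob 0 1]_x \int[normal_prob 0 1]_y (g (a * x + b * y)%R)%:E =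
   \int[normal_prob 0 1]_x (g x)%:E)%E.
Proof.
move=> a0 b0 ab cg g0.
have mg : measurable_fun [set: R] g by exact: continuous_measurable_fun.
pose h (p : R * R) := (g p.2 * normal_pdf (a * p.1) b p.2)%:E.
have mpdf : measurable_fun [set: R * R] (fun p : R * R => normal_pdf (a * p.1) b p.2).
  rewrite [X in measurable_fun _ X](_ : _ = fun p : R * R => normal_peak b * expR (- (p.2 - a * p.1) ^+ 2 / (b ^+ 2 *+ 2))); last first.
    by apply/funext => p; rewrite normal_pdfE// gt_eqF.
  apply: measurable_funM => //; apply: measurableT_comp => //.
  apply: measurable_funM => //; apply: measurableT_comp => //.
  apply: measurable_funX; apply: measurable_funB => //.
  by apply: measurable_funM.
have mh : measurable_fun [set: R * R] h.
  apply/measurable_EFinP; apply: measurable_funM => //.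
  exact: measurableT_comp.
have h0 p : (0 <= h p)%E by rewrite lee_fin mulr_ge0// normal_pdf_ge0.
transitivity (\int[normal_prob 0 1]_x \int[lebesgue_measure]_u h (x, u))%E.
  apply: eq_integral => x _.
  by rewrite -integral_normal_prob_affine// ge0_integral_normal_prob_EFin.
rewrite ge0_integral_normal_prob; last 2 first.
- exact: (measurable_fun_fubini_tonelli_F (m2 := lebesgue_measure)).
- by move=> x; exact: integral_ge0.
pose k (p : R * R) := (h p * (normal_pdf 0 1 p.1)%:E)%E.
transitivity (\int[lebesgue_measure]_x \int[lebesgue_measure]_u k (x, u))%E.
  apply: eq_integral => x _; rewrite /k /=.
  rewrite ge0_integralZr//; first exact: measurableT_comp.
  by rewrite lee_fin normal_pdf_ge0.
transitivity (\int[lebesgue_measure]_u \int[lebesgue_measure]_x k (x, u))%E.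
  apply: (@fubini_tonelli _ _ _ _ R lebesgue_measure lebesgue_measure k).
    apply: emeasurable_funM => //; apply/measurable_EFinP.
    by apply: measurableT_comp => //; exact: measurable_normal_pdf.
  by move=> p; rewrite mule_ge0// lee_fin normal_pdf_ge0.
rewrite ge0_integral_normal_prob_EFin//; apply: eq_integral => u _.
under eq_integral => x _ do
  rewrite /k /h /= -EFinM -mulrA normal_pdf_conv// mulrA EFinM.
rewrite ge0_integralZl//.
- by rewrite integral_normal_pdf mule1.
- by apply/measurable_EFinP; exact: measurable_normal_pdf.
- by move=> x _; rewrite lee_fin normal_pdf_ge0.
- by rewrite lee_fin mulr_ge0// normal_pdf_ge0.
Qed.

(** * Moments of the standard normal law *)

Lemma normal_prob_mgf (R : realType) (t : R) :
  (\int[normal_prob 0 1]_x (expR (t * x))%:E = (expR (t ^+ 2 / 2))%:E)%E.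
Proof.
have mexp : measurable_fun [set: R] (fun x => expR (t * x)).
  by apply: measurableT_comp => //; apply: measurable_funM.
rewrite ge0_integral_normal_prob_EFin//.
under eq_integral => x _.
  rewrite (_ : _ * _ = expR (t ^+ 2 / 2) * normal_pdf t 1 x); last first.
    rewrite !normal_pdfE ?oner_eq0// /normal_fun mulrCA [RHS]mulrCA -!expRD.
    by congr (_ * expR _); rewrite !subr0 expr1n; field.
  rewrite EFinM; over.
rewrite ge0_integralZl//.
- by rewrite integral_normal_pdf mule1.
- by apply/measurable_EFinP; exact: measurable_normal_pdf.
- by move=> x _; rewrite lee_fin normal_pdf_ge0.
Qed.

Lemma integrable_normal_expR (R : realType) (t : R) :
  (normal_prob 0 1).-integrable [set: R] (fun x => (expR (t * x))%:E).
Proof.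
apply/integrableP; split.
  apply/measurable_EFinP; apply: measurableT_comp => //; exact: measurable_funM.
under eq_integral => x _ do rewrite gee0_abs ?lee_fin ?expR_ge0//.
by rewrite normal_prob_mgf ltry.
Qed.

Lemma integrable_normal_norm_exp (R : realType) (n : nat) :
  (normal_prob 0 1).-integrable [set: R] (fun x : R => (`|x| ^+ n)%:E).
Proof.
case: n => [|n].
  under eq_fun do rewrite expr0.
  exact: finite_measure_integrable_cst.
(* With N = n + 1, |x|^N / N! <= exp |x| <= exp x + exp (-x). *)
pose g x : R := n.+1`!%:R * (expR (1 * x) + expR (-1 * x)).
have ig : (normal_prob 0 1).-integrable [set: R] (EFin \o g).
  rewrite (_ : EFin \o g = fun x => (n.+1`!%:R%:E * ((expR (1 * x))%:E + (expR (-1 * x))%:E))%E).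
    by apply: integrableZl => //; apply: integrableD => //; exact: integrable_normal_expR.
  by apply/funext => x; rewrite /= EFinM EFinD.
apply: (le_integrable _ _ _ ig) => //.
- apply/measurable_EFinP; by apply: measurable_funX; exact: normr_measurable.
- move=> x _; rewrite /= lee_fin normrX normr_id.
  rewrite [leRHS]ger0_norm; last by rewrite mulr_ge0// addr_ge0// expR_ge0.
  rewrite /g mul1r mulN1r -ler_pdivrMl ?ltr0n ?fact_gt0// mulrC.
  apply: (@le_trans _ _ (expR `|x|)).
    apply: le_trans (expR_ge1Dxn n (normr_ge0 x)).
    by rewrite lerDr.
  by case: (ler0P x) => _; rewrite ?lerDl ?lerDr expR_ge0.
Qed.

Lemma sinhR_ge (R : realType) (x : R) : 0 <= x -> 2 * x <= expR x - expR (- x).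
Proof.
move=> x0; pose f (y : R) := expR y - expR (- y) - 2 * y.
have df (y : R) : is_derive y 1 f (expR y + expR (- y) - 2).
  by apply: is_derive_eq; rewrite /GRing.scale /=; ring.
suff : f 0 <= f x by rewrite /f oppr0 !subrr mulr0 subr0; lra.
have [<-//|x1] := eqVneq 0 x.
have x2 : 0 < x by rewrite lt_neqAle x1.
have [|c _] := @MVT _ f (fun y => expR y + expR (- y) - 2) 0 x x2 (fun y _ => df y).
  by apply: derivable_within_continuous => y _; apply: ex_derive.
move=> e; rewrite -subr_ge0 e subr0 mulr_ge0//.
have p := expR_gt0 c; rewrite expRN.
have -> : expR c + (expR c)^-1 - 2 = (expR c - 1) ^+ 2 / expR c by field; rewrite gt_eqF.
by rewrite divr_ge0 ?sqr_ge0// ltW.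
Qed.

(** The right side is (2 sinh (x/2))^2. The inequality turns the generating function at t and -t
    into a bound on the second moment, without differentiating under the integral. *)
Lemma expR_quad_le (R : realType) (x : R) : x ^+ 2 <= expR x + expR (- x) - 2.
Proof.
wlog x0 : x / 0 <= x.
  move=> h; have [/h//|/ltW x0] := leP 0 x.
  by have := h (- x); rewrite oppr_ge0 sqrrN opprK => /(_ x0); lra.
have h := @sinhR_ge R (x / 2) (divr_ge0 x0 (ler0n _ 2)).
have -> : expR x + expR (- x) - 2 = (expR (x / 2) - expR (- (x / 2))) ^+ 2.
  rewrite [in LHS](splitr x) opprD !expRD !expRN.
  by field; rewrite gt_eqF// expR_gt0.
have : x <= expR (x / 2) - expR (- (x / 2)) by lra.
by move=> xe; rewrite ler_sqr ?nnegrE// (le_trans x0).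
Qed.

(** Inverts 1 - t^2/2 <= exp (- t^2/2). The right side is t^2/2 to leading order, as the second
    moment bound requires when t tends to 0. *)
Lemma expR_half_sq_le (R : realType) (t : R) : t ^+ 2 <= 1 ->
  expR (t ^+ 2 / 2) - 1 <= t ^+ 2 / (2 - t ^+ 2).
Proof.
move=> t1; set y := t ^+ 2 in t1 *; have y0 : 0 <= y by exact: sqr_ge0.
have := expR_ge1Dx (- (y / 2)); rewrite expRN => h.
have e0 := expR_gt0 (y / 2).
have -> : y / (2 - y) = (1 - y / 2)^-1 - 1 by field; rewrite gt_eqF//; lra.
by rewrite lerD2r -[leLHS]invrK lef_pV2 ?posrE ?invr_gt0//; lra.
Qed.

Lemma integrable_normal_id (R : realType) :
  (normal_prob 0 1).-integrable [set: R] (fun x : R => x%:E).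
Proof.
apply: (le_integrable _ _ _ (integrable_normal_norm_exp R 1)) => //.
  exact/measurable_EFinP.
by move=> x _; rewrite /= lee_fin normr_id.
Qed.

Lemma integrable_normal_sqr (R : realType) :
  (normal_prob 0 1).-integrable [set: R] (fun x : R => (x ^+ 2)%:E).
Proof.
apply: (le_integrable _ _ _ (integrable_normal_norm_exp R 2)) => //.
  by apply/measurable_EFinP; exact: measurable_funX.
by move=> x _; rewrite /= lee_fin !normrX normr_id.
Qed.

Lemma integrable_addr {d : measure_display} {T : measurableType d} {R : realType}
    {mu : {measure set T -> \bar R}} {f g : T -> R} :
  mu.-integrable [set: T] (EFin \o f) -> mu.-integrable [set: T] (EFin \o g) ->
  mu.-integrable [set: T] (EFin \o (fun x => f x + g x)).
Proof. by move=> hf hg; exact: (integrableD measurableT hf hg). Qed.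

Lemma integrable_subr {d : measure_display} {T : measurableType d} {R : realType}
    {mu : {measure set T -> \bar R}} {f g : T -> R} :
  mu.-integrable [set: T] (EFin \o f) -> mu.-integrable [set: T] (EFin \o g) ->
  mu.-integrable [set: T] (EFin \o (fun x => f x - g x)).
Proof. by move=> hf hg; exact: (integrableB measurableT hf hg). Qed.

Lemma integrable_scaler {d : measure_display} {T : measurableType d} {R : realType}
    {mu : {measure set T -> \bar R}} (k : R) {f : T -> R} :
  mu.-integrable [set: T] (EFin \o f) ->
  mu.-integrable [set: T] (EFin \o (fun x => k * f x)).
Proof. by move=> hf; exact: (integrableZl measurableT k hf). Qed.

Lemma Rintegral_prob_cst {d : measure_display} {T : measurableType d}
    {R : realType} (P : probability T R) (r : R) : \int[P]_x r = r.
Proof.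
rewrite Rintegral_cst// -[RHS]mulr1; congr (_ * _).
by rewrite [X in fine X]probability_setT.
Qed.

Lemma prob_integrable_cst {d : measure_display} {T : measurableType d}
    {R : realType} (P : probability T R) (r : R) :
  P.-integrable [set: T] (fun=> r%:E).
Proof. exact: finite_measure_integrable_cst. Qed.

Lemma Rintegral_normal_expR (R : realType) (t : R) :
  \int[normal_prob 0 1]_x (expR (t * x)) = expR (t ^+ 2 / 2).
Proof. by rewrite /Rintegral normal_prob_mgf. Qed.

(** Integrating 1 + t x <= exp (t x) gives t e <= exp (t^2/2) - 1 <= t^2 for |t| <= 1; a small t of
    the sign of e then contradicts e <> 0. *)
Lemma normal_mean (R : realType) : \int[normal_prob 0 1]_x x = 0 :> R.
Proof.
set e := Rintegral _ _ _.
have H (t : R) : t ^+ 2 <= 1 -> t * e <= t ^+ 2.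
  move=> t1; have : \int[normal_prob 0 1]_x (1 + t * x) <= \int[normal_prob 0 1]_x (expR (t * x)).
    apply: le_Rintegral => //; [|exact: integrable_normal_expR|by move=> x _; exact: expR_ge1Dx].
    apply: integrable_addr => //; first exact: prob_integrable_cst.
    by apply: integrable_scaler => //; exact: integrable_normal_id.
  rewrite RintegralD//; last 2 first.
  - exact: prob_integrable_cst.
  - by apply: integrable_scaler => //; exact: integrable_normal_id.
  rewrite Rintegral_prob_cst RintegralZl//; last exact: integrable_normal_id.
  rewrite -/e Rintegral_normal_expR => h.
  have := expR_half_sq_le _ _ t1.
  have : t ^+ 2 / (2 - t ^+ 2) <= t ^+ 2.
    by rewrite ler_pdivrMr ?ler_peMr ?sqr_ge0//; lra.
  by lra.
apply/eqP; rewrite eq_le; apply/andP; split; rewrite leNgt; apply/negP => e0.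
- have m0 : 0 < Num.min 1 (e / 2) by rewrite lt_min ltr01 divr_gt0.
  have := H (Num.min 1 (e / 2)); rewrite expr_le1// ?ge_min ?lexx//; last exact: ltW.
  move=> /(_ isT); rewrite expr2 ler_pM2l//.
  by rewrite leNgt gt_min; apply/negP; rewrite negbK; apply/orP; right; lra.
- have m0 : 0 < Num.min 1 (- e / 2) by rewrite lt_min ltr01 divr_gt0// oppr_gt0.
  have := H (- Num.min 1 (- e / 2)); rewrite sqrrN expr_le1// ?ge_min ?lexx//; last exact: ltW.
  move=> /(_ isT); rewrite expr2 mulNr -mulrN ler_pM2l//.
  by rewrite leNgt gt_min; apply/negP; rewrite negbK; apply/orP; right; lra.
Qed.

(* Its value is 1, but only [normal_m2 R <= 1] is needed: the second moment enters both
   sides of the comparison through the same factor. *)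
Definition normal_m2 (R : realType) : R := \int[normal_prob 0 1]_x (x ^+ 2).

Lemma normal_m2_ge0 (R : realType) : 0 <= normal_m2 R.
Proof. by apply: Rintegral_ge0 => x _; exact: sqr_ge0. Qed.

Lemma normal_m2_le1 (R : realType) : normal_m2 R <= 1.
Proof.
have H (t : R) : t ^+ 2 <= 1 -> t ^+ 2 * normal_m2 R <= 2 * (t ^+ 2 / (2 - t ^+ 2)).
  move=> t1; have : \int[normal_prob 0 1]_x (t ^+ 2 * x ^+ 2 + 2) <=
      \int[normal_prob 0 1]_x (expR (t * x) + expR (- t * x)).
    apply: le_Rintegral => //.
    - apply: integrable_addr => //; last exact: prob_integrable_cst.
      by apply: integrable_scaler => //; exact: integrable_normal_sqr.
    - by apply: integrable_addr => //; exact: integrable_normal_expR.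
    - by move=> x _; have := expR_quad_le _ (t * x); rewrite exprMn mulNr; lra.
  rewrite [X in _ <= X -> _]RintegralD//; last 2 first.
  - exact: integrable_normal_expR.
  - exact: integrable_normal_expR.
  rewrite [X in X <= _ -> _]RintegralD//; last 2 first.
  - by apply: integrable_scaler => //; exact: integrable_normal_sqr.
  - exact: prob_integrable_cst.
  rewrite Rintegral_prob_cst RintegralZl//; last exact: integrable_normal_sqr.
  rewrite -/(normal_m2 R) !Rintegral_normal_expR sqrrN => h.
  by have := expR_half_sq_le _ _ t1; lra.
(* Here y = t^2. Small y gives the claim: the one chosen below makes [normal_m2 R * y] at most
   [normal_m2 R - 1]. *)
have K (y : R) : 0 < y <= 1 -> normal_m2 R * (2 - y) <= 2.
  move=> /andP[y0 y1]; have sy : Num.sqrt y ^+ 2 = y by rewrite sqr_sqrtr// ltW.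
  have := H (Num.sqrt y); rewrite sy => /(_ y1).
  rewrite [leRHS]mulrA ler_pdivlMr; last lra.
  by rewrite -mulrA [leRHS]mulrC ler_pM2l.
rewrite leNgt; apply/negP => m1.
have := K (Num.min 1 ((normal_m2 R - 1) / normal_m2 R)).
have m0 : 0 < normal_m2 R by lra.
rewrite lt_min ltr01 divr_gt0 ?subr_gt0//= ge_min lexx/= => /(_ isT).
rewrite mulrBr lerBlDr.
have : normal_m2 R * Num.min 1 ((normal_m2 R - 1) / normal_m2 R) <= normal_m2 R - 1.
  by rewrite -ler_pdivlMl// ge_min mulrC lexx orbT.
by lra.
Qed.

(** * Averaging operators on Lipschitz functions *)

(** On a trivial space the second clause alone would not force [0 <= L]. *)
Definition lip {R : realType} {V : normedModType R} (L : R) (f : V -> R) : Prop :=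
  0 <= L /\ forall x y, `|f x - f y| <= L * `|x - y|.

(* The laws live on [measurableTypeR R], which has the sigma-algebra of [R] but another
   display; this is where the library puts [normal_prob]. *)
Definition avg {R : realType} {V : normedModType R} (mu : probability (measurableTypeR R) R) (c : V)
    (f : V -> R) (z : V) : R :=
  \int[mu]_x f (z + x *: c).

Lemma lipschitz_real_continuous (R : realType) (f : R -> R) (K : R) :
  (forall x y, `|f x - f y| <= K * `|x - y|) -> continuous f.
Proof.
move=> H x; apply/cvgrPdist_lt => e e0.
have K0 : 0 < `|K| + 1 by rewrite ltr_wpDl.
near=> y.
apply: le_lt_trans (H x y) _.
apply: (@le_lt_trans _ _ ((`|K| + 1) * `|x - y|)).
  by rewrite ler_wpM2r// (le_trans (ler_norm _))// lerDl.
rewrite -ltr_pdivlMl//; near: y.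
by apply: (cvgr_dist_lt id x); [exact: cvg_id|rewrite mulr_gt0 ?invr_gt0].
Unshelve. all: by end_near. Qed.

Lemma lip_line {R : realType} {V : normedModType R} {L : R} {f : V -> R} (z c : V)
    (x y : R) :
  lip L f -> `|f (z + x *: c) - f (z + y *: c)| <= L * `|c| * `|x - y|.
Proof.
move=> [_ H]; apply: le_trans (H _ _) _.
by rewrite opprD addrACA subrr add0r -scalerBl normrZ [_ * `|c|]mulrC mulrA.
Qed.

Lemma integrable_lipschitz_real {R : realType} (mu : probability (measurableTypeR R) R) (f : R -> R) (K : R) :
  mu.-integrable [set: R] (EFin \o id) ->
  (forall x y, `|f x - f y| <= K * `|x - y|) ->
  mu.-integrable [set: R] (EFin \o f).
Proof.
move=> hmu H.
have mf : measurable_fun [set: R] f.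
  by apply: continuous_measurable_fun; exact: lipschitz_real_continuous H.
have hg : mu.-integrable [set: R] (EFin \o (fun x : R => `|f 0| + `|K| * `|x|)).
  apply: integrable_addr; first exact: prob_integrable_cst.
  by apply: integrable_scaler; have := integrable_abse hmu.
apply: (le_integrable _ _ _ hg) => //; first exact/measurable_EFinP.
move=> x _; rewrite /= lee_fin [leRHS]ger0_norm ?addr_ge0 ?mulr_ge0//.
have -> : f x = f 0 + (f x - f 0) by ring.
apply: le_trans (ler_normD _ _) _; rewrite lerD2l.
apply: le_trans (H _ _) _; rewrite subr0 ler_wpM2r//.
exact: ler_norm.
Qed.

Lemma avg_integrable {R : realType} {V : normedModType R} (mu : probability (measurableTypeR R) R) (c : V)
    (f : V -> R) (L : R) (z : V) :
  mu.-integrable [set: R] (EFin \o id) -> lip L f ->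
  mu.-integrable [set: R] (EFin \o (fun x : R => f (z + x *: c))).
Proof. by move=> hmu H; apply: integrable_lipschitz_real hmu _ => x y; exact: lip_line H. Qed.

Lemma lip_cst {R : realType} {V : normedModType R} (e : R) : lip 0 (fun _ : V => e).
Proof. by split=> // x y; rewrite subrr normr0 mul0r. Qed.


Lemma lipD {R : realType} {V : normedModType R} {L M : R} {f g : V -> R} :
  lip L f -> lip M g -> lip (L + M) (fun x => f x + g x).
Proof.
move=> [L0 Hf] [M0 Hg]; split=> [|x y]; first exact: addr_ge0.
have -> : f x + g x - (f y + g y) = (f x - f y) + (g x - g y) by ring.
by apply: le_trans (ler_normD _ _) _; rewrite mulrDl lerD.
Qed.

Lemma lipZ {R : realType} {V : normedModType R} {L : R} (k : R) {f : V -> R} :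
  lip L f -> lip (`|k| * L) (fun x => k * f x).
Proof.
move=> [L0 Hf]; split=> [|x y]; first exact: mulr_ge0.
by rewrite -mulrBr normrM -mulrA ler_wpM2l.
Qed.

Lemma lip_translate {R : realType} {V : normedModType R} {L : R} {f : V -> R} (z : V) :
  lip L f -> lip L (fun x => f (x + z)).
Proof.
move=> [L0 Hf]; split=> // x y; apply: le_trans (Hf _ _) _.
by rewrite addrAC opprD addrA subrK.
Qed.

Lemma lip_sum {R : realType} {V : normedModType R} (I : Type) (s : seq I)
    (L : I -> R) (f : I -> V -> R) :
  (forall i, lip (L i) (f i)) ->
  lip (\sum_(i <- s) L i) (fun x => \sum_(i <- s) f i x).
Proof.
move=> H; elim: s => [|i s IH].
  rewrite big_nil (_ : (fun x => _) = fun=> 0); first exact: lip_cst.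
  by apply/funext => x; rewrite big_nil.
rewrite big_cons (_ : (fun x => _) = fun x => f i x + \sum_(j <- s) f j x).
  exact: lipD.
by apply/funext => x; rewrite big_cons.
Qed.

Section avg_theory.
Context {R : realType} {V : normedModType R} (mu : probability (measurableTypeR R) R)
  (mu1 : mu.-integrable [set: R] (EFin \o id)).
Implicit Types (f g : V -> R) (c z : V) (L M : R).

Lemma avg_le c f g L M (e : R) z : lip L f -> lip M g ->
  (forall x, f x <= g x + e) -> avg mu c f z <= avg mu c g z + e.
Proof.
move=> Hf Hg fg.
rewrite -[X in _ + X](Rintegral_prob_cst mu) /avg -RintegralD//.
- apply: le_Rintegral => //.
  + exact: avg_integrable Hf.
  + by apply: integrable_addr; [exact: avg_integrable Hg|exact: prob_integrable_cst].
- exact: avg_integrable Hg.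
- exact: prob_integrable_cst.
Qed.

Lemma avg_dist c f g L M (e : R) z : lip L f -> lip M g ->
  (forall x, `|f x - g x| <= e) -> `|avg mu c f z - avg mu c g z| <= e.
Proof.
move=> Hf Hg fg; rewrite ler_distl lerBlDr; apply/andP; split.
  apply: avg_le Hg Hf _ => x; have := fg x.
  by rewrite ler_distl lerBlDr => /andP[].
apply: avg_le Hf Hg _ => x; have := fg x.
by rewrite ler_distl lerBlDr => /andP[].
Qed.

Lemma avg_translate c f z y : avg mu c f (z + y) = avg mu c (fun x => f (x + y)) z.
Proof. by rewrite /avg; apply: eq_Rintegral => x _; rewrite addrAC. Qed.

(** Averaging commutes with translations, so its values at two points are averages at one point of
    two uniformly close functions. *)
Lemma avg_lip c f L : lip L f -> lip L (avg mu c f).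
Proof.
move=> Hf; split=> [|x y]; first by case: Hf.
have -> : avg mu c f x = avg mu c (fun w => f (w + (x - y))) y.
  by rewrite -avg_translate addrC subrK.
apply: (avg_dist _ _ _ L L) => //; first exact: lip_translate.
by move=> z; case: Hf => L0 /(_ (z + (x - y)) z); rewrite [_ - z]addrAC subrr add0r.
Qed.

Lemma avgD c f g L M z : lip L f -> lip M g ->
  avg mu c (fun x => f x + g x) z = avg mu c f z + avg mu c g z.
Proof.
move=> Hf Hg; rewrite /avg RintegralD//.
- exact: avg_integrable Hf.
- exact: avg_integrable Hg.
Qed.

Lemma avgZ c k f L z : lip L f ->
  avg mu c (fun x => k * f x) z = k * avg mu c f z.
Proof. by move=> Hf; rewrite /avg RintegralZl//; exact: avg_integrable Hf. Qed.

Lemma avg_sum c (I : Type) (s : seq I) (F : I -> V -> R) (K : I -> R) z :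
  (forall i, lip (K i) (F i)) ->
  avg mu c (fun x => \sum_(i <- s) F i x) z = \sum_(i <- s) avg mu c (F i) z.
Proof.
move=> H; elim: s => [|i s IH].
  rewrite big_nil /avg; under eq_Rintegral do rewrite big_nil.
  by rewrite Rintegral_prob_cst.
rewrite big_cons -IH -(avgD _ _ _ _ _ _ (H i) (lip_sum _ s _ _ H)).
by congr avg; apply/funext => x; rewrite big_cons.
Qed.

End avg_theory.

(** * Discretization and exchange of averages *)

Import HBSimple.

(* [g] is a simple function with values in [s]; replacing [x] by [g x] turns integrals
   of Lipschitz functions into finite sums, which takes the place of Fubini. *)
Lemma L1_simple {R : realType} (mu : probability (measurableTypeR R) R) (e : R) : 0 < e ->
  mu.-integrable [set: R] (EFin \o id) ->
  exists (g : R -> R) (s : seq R),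
    [/\ measurable_fun [set: R] g, uniq s, forall x, g x \in s &
        \int[mu]_x `|x - g x| <= e].
Proof.
move=> e0 hmu.
have [g_ [_ _]] := approximation_sfun_integrable measurableT hmu.
move=> /fine_cvgP[_ /cvgrPdist_lt/(_ e e0)] [N _ /(_ N (leqnn N))] /=.
rewrite sub0r normrN => h.
exists (g_ N), (finmap.enum_fset (fset_set (range (g_ N)))); split => //.
- exact: (measurable_funPT (g_ N)).
- exact: finmap.fset_uniq.
- by move=> x; rewrite in_fset_set; [apply/mem_set; exists x|exact: fimfunP].
- by apply: le_trans (ltW h); exact: ler_norm.
Qed.

Lemma finite_range_decomp {R : realType} {T : Type} (g : T -> R) (s : seq R)
    (h : R -> R) (x : T) : uniq s -> g x \in s ->
  h (g x) = \sum_(y <- s) h y * \1_(g @^-1` [set y]) x.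
Proof.
move=> us gs; rewrite (bigD1_seq (g x))//= big1 => [|y yg].
  by rewrite indicE mem_set// mulr1 addr0.
rewrite indicE memNset ?mulr0// => /= gy.
by move: yg; rewrite gy eqxx.
Qed.

Lemma integrable_sumr {d : measure_display} {T : measurableType d} {R : realType}
    (mu : {measure set T -> \bar R}) (I : Type) (s : seq I) (h : I -> T -> R) :
  (forall i, mu.-integrable [set: T] (EFin \o h i)) ->
  mu.-integrable [set: T] (EFin \o (fun x => \sum_(i <- s) h i x)).
Proof.
move=> H; rewrite (_ : _ \o _ = fun x => (\sum_(i <- s) (h i x)%:E)%E).
  by apply: (integrable_sum measurableT) => i _; exact: H.
by apply/funext => x /=; rewrite sumEFin.
Qed.

(** Replacing x by [g x] moves the argument of [f] by [|c|] times |x - g x|, and the integral after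
    the replacement is a finite sum weighted by the masses of the fibres of [g]. *)
Lemma avg_simple {R : realType} (mu : probability (measurableTypeR R) R) (e : R)
    (g : R -> R) (s : seq R) :
  mu.-integrable [set: R] (EFin \o id) ->
  measurable_fun [set: R] g -> uniq s -> (forall x, g x \in s) ->
  \int[mu]_x `|x - g x| <= e ->
  forall (V : normedModType R) (c : V) (f : V -> R) (L : R), lip L f -> forall z,
  `|avg mu c f z - \sum_(y <- s) fine (mu (g @^-1` [set y])) * f (z + y *: c)|
    <= L * `|c| * e.
Proof.
move=> hmu mg us gs ge V c f L Hf z.
have mgy (y : R) : @measurable _ (measurableTypeR R) (g @^-1` [set y]).
  by rewrite -[X in measurable X]setTI; apply: mg.
have hz := avg_integrable mu c f L z hmu Hf.
have iz y : mu.-integrable [set: R] (EFin \o (\1_(g @^-1` [set y]) : R -> R)).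
  exact: integrable_indic.
have -> : \sum_(y <- s) fine (mu (g @^-1` [set y])) * f (z + y *: c) =
    \int[mu]_x f (z + g x *: c).
  under [RHS]eq_Rintegral => x _ do
    rewrite (finite_range_decomp g s (fun y => f (z + y *: c)) x us (gs x)).
  elim: {us gs} s => [|y s IH].
    rewrite big_nil; under eq_Rintegral do rewrite big_nil.
    by rewrite Rintegral_prob_cst.
  rewrite big_cons IH; under [RHS]eq_Rintegral do rewrite big_cons.
  rewrite RintegralD//.
  - rewrite RintegralZl// /Rintegral integral_indic// setIT mulrC.
    by [].
  - exact: integrable_scaler.
  - by apply: integrable_sumr => y'; exact: integrable_scaler.
have ig : mu.-integrable [set: R] (EFin \o (fun x => f (z + g x *: c))).
  rewrite (_ : EFin \o _ = EFin \o (fun x => \sum_(y <- s) f (z + y *: c) * \1_(g @^-1` [set y]) x)).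
    by apply: integrable_sumr => y'; exact: integrable_scaler.
  apply/funext => x /=; congr EFin.
  exact: (finite_range_decomp g s (fun y => f (z + y *: c)) x us (gs x)).
have ixg : mu.-integrable [set: R] (EFin \o (fun x => `|x - g x|)).
  have ig' : mu.-integrable [set: R] (EFin \o g).
    rewrite (_ : EFin \o _ = EFin \o (fun x => \sum_(y <- s) y * \1_(g @^-1` [set y]) x)).
      by apply: integrable_sumr => y'; exact: integrable_scaler.
    apply/funext => x /=; congr EFin.
    exact: (finite_range_decomp g s id x us (gs x)).
  exact: (integrable_abse (integrable_subr hmu ig')).
rewrite /avg -RintegralB//.
apply: le_trans (le_normr_Rintegral _ _) _ => //; first exact: integrable_subr.
apply: (@le_trans _ _ (\int[mu]_x (L * `|c| * `|x - g x|))).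
  apply: le_Rintegral => //.
  - exact: (integrable_abse (integrable_subr hz ig)).
  - exact: integrable_scaler.
  - by move=> x _; exact: lip_line Hf.
rewrite RintegralZl// ler_wpM2l// mulr_ge0//.
by case: Hf.
Qed.

(** The nodes and weights depend on [mu] and [e] only. This uniformity in [f], [c] and [z] allows
    the approximation to be used under another average. *)
Lemma avg_approx {R : realType} (mu : probability (measurableTypeR R) R) (e : R) : 0 < e ->
  mu.-integrable [set: R] (EFin \o id) ->
  exists s : seq (R * R), forall (V : normedModType R) (c : V) (f : V -> R) (L : R),
    lip L f -> forall z,
    `|avg mu c f z - \sum_(q <- s) q.1 * f (z + q.2 *: c)| <= L * `|c| * e.
Proof.
move=> e0 hmu; have [g [s [mg us gs ge]]] := L1_simple mu e e0 hmu.
exists [seq (fine (mu (g @^-1` [set y])), y) | y <- s] => V c f L Hf z.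
by rewrite big_map; exact: (avg_simple mu e g s hmu mg us gs ge V c f L Hf z).
Qed.

Lemma eq_of_dist_le {R : realType} (x y K : R) :
  (forall e, 0 < e -> `|x - y| <= K * e) -> x = y.
Proof.
move=> H; apply/eqP; rewrite -subr_eq0 -normr_le0 leNgt; apply/negP => p.
have K1 : 0 < `|K| + 1 by rewrite ltr_wpDl.
have := H (`|x - y| / (`|K| + 1)); rewrite divr_gt0// => /(_ isT).
rewrite mulrCA -[leLHS]mulr1 ler_pM2l// ler_pdivlMr// mul1r.
by have := ler_norm K; lra.
Qed.

(** A finite combination of translates commutes with averaging by linearity. Putting it in place of
    [avg mu a], outside or inside the other average, costs at most L |a| e each time. *)
Lemma avgC {R : realType} {V : normedModType R} (mu nu : probability (measurableTypeR R) R) (a b : V)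
    (f : V -> R) (L : R) (z : V) :
  mu.-integrable [set: R] (EFin \o id) -> nu.-integrable [set: R] (EFin \o id) ->
  lip L f -> avg mu a (avg nu b f) z = avg nu b (avg mu a f) z.
Proof.
move=> hmu hnu Hf; apply: (eq_of_dist_le _ _ (2 * (L * `|a|))) => e e0.
have [s Hs] := avg_approx mu e e0 hmu.
pose A (h : V -> R) z := \sum_(q <- s) q.1 * h (z + q.2 *: a).
have lipA h M : lip M h -> lip (\sum_(q <- s) `|q.1| * M) (A h).
  by move=> Hh; apply: lip_sum => q; apply: lipZ; exact: lip_translate.
have AE : A (avg nu b f) z = avg nu b (A f) z.
  rewrite [RHS](avg_sum _ _ _ _ _ (fun q x => q.1 * f (x + q.2 *: a)) (fun q => `|q.1| * L))//; last first.
    by move=> q; apply: lipZ; exact: lip_translate.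
  apply: eq_bigr => q _; rewrite (avgZ _ _ _ _ _ L)//; last exact: lip_translate.
  by rewrite avg_translate.
have h1 := Hs V a (avg nu b f) L (avg_lip _ hnu _ _ _ Hf) z.
have h2 : `|avg nu b (avg mu a f) z - avg nu b (A f) z| <= L * `|a| * e.
  apply: (avg_dist _ hnu _ _ _ L); [exact: avg_lip|exact: lipA Hf|].
  by move=> x; exact: Hs.
rewrite -/(A (avg nu b f) z) AE in h1.
have -> : avg mu a (avg nu b f) z - avg nu b (avg mu a f) z =
  (avg mu a (avg nu b f) z - avg nu b (A f) z) - (avg nu b (avg mu a f) z - avg nu b (A f) z) by ring.
by apply: le_trans (ler_normB _ _) _; lra.
Qed.

(** * Iterated Gaussian averages *)

Definition gavg {R : realType} {V : normedModType R} (c : V) (f : V -> R) : V -> R :=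
  avg (normal_prob 0 1) c f.

Definition gavgs {R : realType} {V : normedModType R} (cs : seq V) (f : V -> R) : V -> R :=
  foldr gavg f cs.

Lemma normal_integrable_id {R : realType} :
  (@normal_prob R 0 1).-integrable [set: R] (EFin \o id).
Proof. exact: integrable_normal_id. Qed.

Lemma gavg_lip {R : realType} {V : normedModType R} (c : V) {f : V -> R} {L : R} :
  lip L f -> lip L (gavg c f).
Proof. by move=> Hf; apply: avg_lip => //; exact: normal_integrable_id. Qed.

Lemma gavgs_lip {R : realType} {V : normedModType R} (cs : seq V) {f : V -> R} {L : R} :
  lip L f -> lip L (gavgs cs f).
Proof. by move=> Hf; elim: cs => //= c cs; exact: gavg_lip. Qed.

Lemma gavgC {R : realType} {V : normedModType R} (a b : V) (f : V -> R) (L : R) :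
  lip L f -> gavg a (gavg b f) = gavg b (gavg a f).
Proof.
by move=> Hf; apply/funext => z; apply: (avgC _ _ _ _ _ L) => //; exact: normal_integrable_id.
Qed.

Lemma gavg_gavgsC {R : realType} {V : normedModType R} (a : V) (cs : seq V) (f : V -> R) (L : R) :
  lip L f -> gavg a (gavgs cs f) = gavgs cs (gavg a f).
Proof.
move=> Hf; elim: cs => //= c cs <-.
by rewrite (gavgC a c _ L)//; exact: gavgs_lip.
Qed.

Lemma gavgsC {R : realType} {V : normedModType R} (bs cs : seq V) (f : V -> R) (L : R) :
  lip L f -> gavgs bs (gavgs cs f) = gavgs cs (gavgs bs f).
Proof.
move=> Hf; elim: bs => //= b bs ->.
by rewrite (gavg_gavgsC b cs _ L)//; exact: gavgs_lip.
Qed.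

Lemma gavgs_le {R : realType} {V : normedModType R} (cs : seq V) (f g : V -> R) (L M e : R) :
  lip L f -> lip M g -> (forall z, f z <= g z + e) ->
  forall z, gavgs cs f z <= gavgs cs g z + e.
Proof.
move=> Hf Hg fg; elim: cs => //= c cs IH z.
apply: (avg_le _ _ _ _ _ L M) => //; [exact: normal_integrable_id|exact: gavgs_lip|exact: gavgs_lip].
Qed.

Lemma max0_dist {R : realType} (p q : R) :
  `|Num.max p 0 - Num.max q 0| <= `|p - q|.
Proof.
have h1 := ler_norm (p - q); have := ler_norm (q - p); rewrite distrC => h2.
rewrite ler_norml; apply/andP.
by case: (leP p 0); case: (leP q 0) => A B; split; lra.
Qed.

(** Identities proved by Tonelli hold for nonnegative functions; positive and negative parts carry
    them over to Lipschitz functions with the same constant. *)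
Lemma lipschitz_pos_neg {R : realType} (K : R) (h : R -> R) :
  (forall x y, `|h x - h y| <= K * `|x - y|) ->
  exists hp hm : R -> R,
    [/\ forall x, 0 <= hp x, forall x, 0 <= hm x,
        forall x y, `|hp x - hp y| <= K * `|x - y|,
        forall x y, `|hm x - hm y| <= K * `|x - y| &
        forall x, h x = hp x - hm x].
Proof.
move=> Hh; exists (fun x => Num.max (h x) 0), (fun x => Num.max (- h x) 0); split.
- by move=> x; rewrite le_max lexx orbT.
- by move=> x; rewrite le_max lexx orbT.
- by move=> x y; apply: le_trans (Hh x y); exact: max0_dist.
- move=> x y; apply: le_trans (Hh x y); apply: le_trans (max0_dist _ _) _.
  by rewrite -opprD normrN.
- by move=> x; case: (leP (h x) 0); case: (leP (- h x) 0) => A B; lra.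
Qed.

Lemma normal_prob_stable_lipschitz {R : realType} (a b K : R) (h : R -> R) :
  0 < a -> 0 < b -> a ^+ 2 + b ^+ 2 = 1 ->
  (forall x y, `|h x - h y| <= K * `|x - y|) ->
  \int[normal_prob 0 1]_x \int[normal_prob 0 1]_y h (a * x + b * y) =
  \int[normal_prob 0 1]_x h x.
Proof.
move=> a0 b0 ab Hh.
pose lin (k : R -> R) := forall x y, `|k x - k y| <= K * `|x - y|.
pose J (k : R -> R) x := \int[normal_prob 0 1]_y k (a * x + b * y).
have ii := @normal_integrable_id R.
have inner (k : R -> R) x : lin k ->
    (normal_prob 0 1).-integrable [set: R] (EFin \o (fun y => k (a * x + b * y))).
  move=> Hk; apply: (integrable_lipschitz_real _ _ (K * b) ii) => y y'.
  apply: le_trans (Hk _ _) _; rewrite opprD addrACA subrr add0r -mulrBr.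
  by rewrite normrM (gtr0_norm b0) mulrA.
have outer (k : R -> R) : lin k ->
    (normal_prob 0 1).-integrable [set: R] (EFin \o J k).
  move=> Hk; apply: (integrable_lipschitz_real _ _ (K * a) ii) => x x'.
  rewrite /J -RintegralB//; [|exact: inner|exact: inner].
  have iB := integrable_subr (inner k x Hk) (inner k x' Hk).
  apply: le_trans (le_normr_Rintegral _ _) _ => //.
  rewrite -[leRHS](Rintegral_prob_cst (@normal_prob R 0 1)).
  apply: le_Rintegral => //; [exact: (integrable_abse iB)|exact: prob_integrable_cst|].
  move=> y _; apply: le_trans (Hk _ _) _; rewrite opprD addrACA subrr addr0 -mulrBr.
  by rewrite normrM (gtr0_norm a0) mulrA.
have nn (k : R -> R) : (forall x, 0 <= k x) -> lin k ->
    \int[normal_prob 0 1]_x J k x = \int[normal_prob 0 1]_x k x.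
  move=> k0 Hk; rewrite [RHS]/Rintegral -(integral_normal_prob_stable _ a b k)//; last first.
    exact: lipschitz_real_continuous Hk.
  congr fine; apply: eq_integral => x _; rewrite fineK//.
  by apply: integrable_fin_num => //; exact: inner.
have [hp [hm [hp0 hm0 linp linm hE]]] := lipschitz_pos_neg K h Hh.
have idl (k : R -> R) : lin k -> (normal_prob 0 1).-integrable [set: R] (EFin \o k).
  by move=> Hk; exact: integrable_lipschitz_real ii Hk.
under [RHS]eq_Rintegral do rewrite hE.
rewrite [RHS]RintegralB//; [|exact: idl|exact: idl].
rewrite -(nn hp)// -(nn hm)// -RintegralB//; [|exact: outer|exact: outer].
apply: eq_Rintegral => x _; rewrite /J -RintegralB//; [|exact: inner|exact: inner].
by apply: eq_Rintegral => y _; rewrite hE.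
Qed.

Lemma gavg_stable {R : realType} {V : normedModType R} (a b : R) (c : V) (f : V -> R) (L : R) :
  0 < a -> 0 < b -> a ^+ 2 + b ^+ 2 = 1 -> lip L f ->
  gavg (a *: c) (gavg (b *: c) f) = gavg c f.
Proof.
move=> a0 b0 ab Hf; apply/funext => z.
have H (x y : R) := lip_line z c x y Hf.
apply: etrans (normal_prob_stable_lipschitz a b _ (fun x => f (z + x *: c)) a0 b0 ab H).
apply: eq_Rintegral => x _; apply: eq_Rintegral => y _.
by rewrite !scalerA -addrA -scalerDl [x * a]mulrC [y * b]mulrC.
Qed.

Lemma gavgs_stable {R : realType} {V : normedModType R} (a b : R) (cs : seq V) (f : V -> R) (L : R) :
  0 < a -> 0 < b -> a ^+ 2 + b ^+ 2 = 1 -> lip L f ->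
  gavgs [seq a *: c | c <- cs] (gavgs [seq b *: c | c <- cs] f) = gavgs cs f.
Proof.
move=> a0 b0 ab Hf; elim: cs => //= c cs IH.
rewrite -(gavg_stable a b c _ L)//; last exact: gavgs_lip.
(* The average along [b *: c] is moved inside the averages along the other scaled vectors, so that
   the two sides agree. *)
congr gavg; rewrite -IH [RHS](gavg_gavgsC _ _ _ L); last exact: gavgs_lip.
by rewrite (gavg_gavgsC _ _ _ L).
Qed.

(** * Log-sum-exp *)

Lemma coord_le_mx_norm {R : realType} {m n : nat} (x : 'M[R]_(m, n)) i j :
  `|x i j| <= `|x|.
Proof.
rewrite [leRHS]mx_normrE.
by apply: (le_bigmax _ (fun i : 'I_m * 'I_n => `|x i.1 i.2|) (i, j)).
Qed.

Lemma expR_sub1_le {R : realType} (t : R) : `|t| <= 2^-1 ->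
  0 <= expR t - 1 - t <= 2 * t ^+ 2.
Proof.
rewrite ler_norml => /andP[t1 t2]; have h := expR_ge1Dx t; apply/andP; split; first lra.
have := expR_ge1Dx (- t); rewrite expRN => h'.
have e0 := expR_gt0 t.
have : expR t <= (1 - t)^-1 by rewrite -[leLHS]invrK lef_pV2 ?posrE ?invr_gt0//; lra.
have -> : (1 - t)^-1 = 1 + t + t ^+ 2 * (1 - t)^-1 by field; rewrite gt_eqF//; lra.
have : (1 - t)^-1 <= 2.
  by rewrite -[leRHS]invrK lef_pV2 ?posrE ?invr_gt0//; lra.
move/(ler_wpM2l (sqr_ge0 t)); lra.
Qed.

(** The mean value theorem for the remainder, whose derivative exp y - 1 - y is bounded by 2 y^2. *)
Lemma expR_taylor2 {R : realType} (t : R) : `|t| <= 2^-1 ->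
  `|expR t - 1 - t - t ^+ 2 / 2| <= 2 * `|t| ^+ 3.
Proof.
move=> tle; pose g (y : R) := expR y - 1 - y - y ^+ 2 / 2.
pose dg (y : R) := expR y - 1 - y.
have isd (y : R) : is_derive y 1 g (dg y).
  by apply: is_derive_eq; rewrite /dg /GRing.scale /=; field.
have g0 : g 0 = 0 by rewrite /g expR0 expr0n /=; ring.
have cont (a b : R) : {within `[a, b], continuous g}.
  by apply: derivable_within_continuous => y _; apply: ex_derive.
suff [c ct gt] : exists2 c, `|c| <= `|t| & g t = dg c * t.
  rewrite -/(g t) gt normrM exprSr mulrA ler_wpM2r//.
  have /andP[d0 d1] := expR_sub1_le c (le_trans ct tle).
  rewrite (ger0_norm d0); apply: le_trans d1 _; rewrite ler_wpM2l//.
  by rewrite -[c ^+ 2]real_normK ?num_real// lerXn2r ?nnegrE.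
have [t0|t0] := leP 0 t.
  have [c] := @MVT_segment _ g dg 0 t t0 (fun y _ => isd y) (cont _ _).
  rewrite in_itv /= => /andP[c0 ct]; rewrite g0 !subr0 => e.
  by exists c => //; rewrite !ger0_norm.
have [c] := @MVT_segment _ g dg t 0 (ltW t0) (fun y _ => isd y) (cont _ _).
rewrite in_itv /= => /andP[c0 ct]; rewrite g0 !sub0r mulrN => /oppr_inj e.
by exists c => //; rewrite (ler0_norm ct) (ltr0_norm t0) lerN2.
Qed.

(** A cumulant expansion: [x] is a centred random variable under the weights [p], so the leading
    term of the logarithm is half its variance. *)
Lemma ln_tilt_centered {R : realType} (n : nat) (p x : 'I_n -> R) (D : R) :
  (forall i, 0 <= p i) -> \sum_i p i = 1 -> \sum_i p i * x i = 0 ->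
  0 <= D -> (forall i, `|x i| <= D) ->
  `|ln (\sum_i p i * expR (x i)) - 2^-1 * \sum_i p i * x i ^+ 2| <= 4 * D ^+ 3.
Proof.
move=> p0 p1 px D0 xD.
set S := \sum_i p i * expR (x i); set v := \sum_i p i * x i ^+ 2.
have wsum (f : 'I_n -> R) (B : R) : (forall i, f i <= B) -> \sum_i p i * f i <= B.
  move=> fB; rewrite -[leRHS]mul1r -p1 mulr_suml; apply: ler_sum => i _.
  exact: ler_wpM2l.
have v0 : 0 <= v by apply: sumr_ge0 => i _; rewrite mulr_ge0// sqr_ge0.
have vD : v <= D ^+ 2.
  apply: wsum => i; rewrite -[leLHS]ger0_norm ?sqr_ge0// normrX.
  by rewrite ler_sqr ?nnegrE.
have S1 : 1 <= S.
  have -> : 1 = \sum_i p i * (1 + x i) :> R.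
    rewrite -[LHS]p1 -[LHS]addr0 -[X in _ + X]px -big_split /=.
    by apply: eq_bigr => i _; ring.
  by apply: ler_sum => i _; rewrite ler_wpM2l// expR_ge1Dx.
have SD : S <= expR D.
  by apply: wsum => i; rewrite ler_expR; apply: le_trans (xD i); exact: ler_norm.
have S0 : 0 < S by lra.
(* For D > 1/2 crude bounds suffice: ln S lies in [0, D] and v / 2 in [0, D^2 / 2], and both upper
   ends are at most 4 D^3. *)
have [Dle|Dgt] := leP D 2^-1; last first.
  have l0 : 0 <= ln S by exact: ln_ge0.
  have lD : ln S <= D by rewrite -[leRHS]expRK ler_ln ?posrE ?expR_gt0.
  have h1 : D <= 4 * D ^+ 3.
    have : 0 <= D * ((2 * D - 1) * (2 * D + 1)) by rewrite !mulr_ge0//; lra.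
    lra.
  have h2 : 2^-1 * D ^+ 2 <= 4 * D ^+ 3.
    have : 0 <= D * D * (8 * D - 1) by rewrite !mulr_ge0//; lra.
    lra.
  rewrite ler_norml; apply/andP; split; lra.
have e3 : `|S - 1 - 2^-1 * v| <= 2 * D ^+ 3.
  have -> : S - 1 - 2^-1 * v = \sum_i p i * (expR (x i) - 1 - x i - x i ^+ 2 / 2).
    rewrite -[LHS]subr0 -[X in _ - X]px -[X in S - X]p1 /S /v mulr_sumr -!sumrB.
    by apply: eq_bigr => i _; field.
  apply: le_trans (ler_norm_sum _ _ _) _.
  under eq_bigr do rewrite normrM (ger0_norm (p0 _)).
  apply: wsum => i; apply: le_trans (expR_taylor2 _ _) _.
    exact: le_trans (xD i) Dle.
  by rewrite ler_wpM2l// lerXn2r ?nnegrE.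
have D3 : D ^+ 3 <= D ^+ 2 / 2.
  have : 0 <= D * D * (2^-1 - D) by rewrite !mulr_ge0//; lra.
  lra.
have D4 : D ^+ 4 <= D ^+ 3 / 2.
  have : 0 <= D * D * D * (2^-1 - D) by rewrite !mulr_ge0//; lra.
  lra.
move: e3; rewrite ler_norml => /andP[e3 e3'].
have y1 : 0 <= S - 1 by lra.
(* S - 1 <= v / 2 + 2 D^3 <= 3/2 D^2, so the quadratic error of the logarithm is at most 9/8 D^3. *)
have y2 : (S - 1) ^+ 2 <= 9 / 4 * D ^+ 4.
  have -> : 9 / 4 * D ^+ 4 = (3 / 2 * D ^+ 2) ^+ 2 by field.
  by rewrite ler_sqr ?nnegrE//; [lra|rewrite mulr_ge0// sqr_ge0].
have lnu : ln S <= S - 1.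
  by have := @le_ln1Dx R (S - 1); rewrite addrCA subrr addr0; apply; lra.
have lnl : (S - 1) - (S - 1) ^+ 2 <= ln S.
  have := @le_ln1Dx R (S^-1 - 1); rewrite addrCA subrr addr0 lnV ?posrE// => h.
  have {}h : - ln S <= S^-1 - 1.
    by apply: h; rewrite ltrBrDl subrr invr_gt0.
  have : 1 - S^-1 >= (S - 1) - (S - 1) ^+ 2.
    rewrite -subr_ge0.
    have -> : 1 - S^-1 - (S - 1 - (S - 1) ^+ 2) = (S - 1) ^+ 3 / S.
      by field; rewrite gt_eqF.
    by rewrite divr_ge0 ?exprn_ge0// ltW.
  lra.
have D30 : 0 <= D ^+ 3 by rewrite exprn_ge0.
rewrite ler_norml; apply/andP; split; lra.
Qed.

(** Centring at the mean m leaves |x i - m| <= 2 D, whence the constant 32 = 4 * 2^3. *)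
Lemma ln_tilt {R : realType} (n : nat) (p x : 'I_n -> R) (D : R) :
  (forall i, 0 <= p i) -> \sum_i p i = 1 ->
  0 <= D -> (forall i, `|x i| <= D) ->
  0 < \sum_i p i * expR (x i) ->
  `|ln (\sum_i p i * expR (x i)) - \sum_i p i * x i -
    2^-1 * (\sum_i p i * x i ^+ 2 - (\sum_i p i * x i) ^+ 2)| <= 32 * D ^+ 3.
Proof.
move=> p0 p1 D0 xD S0; set m := \sum_i p i * x i.
have mD : `|m| <= D.
  apply: le_trans (ler_norm_sum _ _ _) _.
  rewrite -[leRHS]mul1r -p1 mulr_suml; apply: ler_sum => i _.
  by rewrite normrM (ger0_norm (p0 _)) ler_wpM2l.
have c0 : \sum_i p i * (x i - m) = 0.
  under eq_bigr do rewrite mulrBr.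
  by rewrite sumrB -mulr_suml p1 mul1r subrr.
have cD i : `|x i - m| <= 2 * D.
  by apply: le_trans (ler_normB _ _) _; have := xD i; lra.
have := ln_tilt_centered n p _ (2 * D) p0 p1 c0 (mulr_ge0 (ler0n _ 2) D0) cD.
have -> : \sum_i p i * expR (x i - m) = (\sum_i p i * expR (x i)) / expR m.
  by rewrite mulr_suml; apply: eq_bigr => i _; rewrite expRB mulrA.
rewrite ln_div ?posrE ?expR_gt0// expRK.
have -> : \sum_i p i * (x i - m) ^+ 2 = \sum_i p i * x i ^+ 2 - m ^+ 2.
  transitivity (\sum_i (p i * x i ^+ 2 - p i * x i * (2 * m) + p i * m ^+ 2)).
    by apply: eq_bigr => i _; ring.
  by rewrite big_split sumrB /= -!mulr_suml p1 -/m; ring.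
by rewrite exprMn; lra.
Qed.

(** By convexity exp u - exp v <= (u - v) exp u, and exp u <= 1. Applied to the logarithm of
    [softmax], which is nonpositive. *)
Lemma expR_dist_le {R : realType} (u v B : R) : u <= 0 -> 0 <= B ->
  u - v <= B -> expR u - expR v <= B.
Proof.
move=> u0 B0 uv; have := expR_ge1Dx (v - u).
have e0 := expR_ge0 u; have e1 : expR u <= 1 by rewrite -expR0 ler_expR.
rewrite expRB ler_pdivlMr ?expR_gt0// => h.
have : (u - v) * expR u <= B.
  apply: (@le_trans _ _ (B * expR u)); first exact: ler_wpM2r.
  by rewrite ler_piMr.
lra.
Qed.

Lemma prod_dist {R : realType} (a b c d : R) : 0 <= a <= 1 -> 0 <= d <= 1 ->
  `|a * b - c * d| <= `|b - d| + `|a - c|.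
Proof.
move=> /andP[a0 a1] /andP[d0 d1].
have -> : a * b - c * d = a * (b - d) + (a - c) * d by ring.
apply: le_trans (ler_normD _ _) _; rewrite !normrM (ger0_norm a0) (ger0_norm d0).
by rewrite lerD// ?ler_piMl ?ler_piMr.
Qed.

Section log_sum_exp.
Context {R : realType} {n : nat}.
Implicit Types (z c : 'rV[R]_n.+1).

(** A smooth maximum: [coord_le_lse] and [lse_le] place it between the largest coordinate and that
    coordinate plus ln (n + 1). Its gradient is [softmax]. *)
Definition lse z : R := ln (\sum_i expR (z ord0 i)).

Definition softmax z i : R := expR (z ord0 i - lse z).

Lemma sum_expR_gt0 z : 0 < \sum_i expR (z ord0 i).
Proof.
rewrite big_ord_recl ltr_pwDl ?expR_gt0//.
by apply: sumr_ge0 => i _; exact: expR_ge0.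
Qed.

Lemma expR_lse z : expR (lse z) = \sum_i expR (z ord0 i).
Proof. by rewrite lnK// posrE sum_expR_gt0. Qed.

Lemma softmax_ge0 z i : 0 <= softmax z i. Proof. exact: expR_ge0. Qed.

Lemma sum_softmax z : \sum_i softmax z i = 1.
Proof.
under eq_bigr do rewrite /softmax expRB.
by rewrite -mulr_suml -expR_lse divff// gt_eqF// expR_gt0.
Qed.

Lemma softmax_le1 z i : softmax z i <= 1.
Proof.
rewrite -(sum_softmax z) (bigD1 i)//= lerDl; apply: sumr_ge0 => j _.
exact: softmax_ge0.
Qed.

Lemma coord_le_lse z i : z ord0 i <= lse z.
Proof. by have := softmax_le1 z i; rewrite -[X in _ <= X]expR0 ler_expR subr_le0. Qed.

Lemma lse_le z (B : R) : (forall i, z ord0 i <= B) -> lse z <= B + ln n.+1%:R.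
Proof.
move=> zB; rewrite -ler_expR expR_lse expRD lnK ?posrE ?ltr0n//.
rewrite mulr_natr -[X in _ *+ X](card_ord n.+1) -sumr_const; apply: ler_sum => i _.
by rewrite ler_expR.
Qed.

Lemma lse_lip : lip 1 lse.
Proof.
split=> // x y; rewrite mul1r.
suff H (a b : 'rV[R]_n.+1) : lse a - lse b <= `|a - b|.
  by rewrite ler_norml lerNl opprB; apply/andP; split; [rewrite distrC; exact: H|exact: H].
rewrite lerBlDl -ler_expR expRD !expR_lse mulr_suml; apply: ler_sum => i _.
rewrite -expRD ler_expR -lerBlDl.
apply: le_trans (coord_le_mx_norm (a - b) ord0 i); rewrite !mxE.
exact: ler_norm.
Qed.

(** The increment is a cumulant generating function under the weights [softmax z], which reduces the
    Taylor expansion of [lse] to [ln_tilt]. *)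
Lemma lse_shift z c :
  lse (z + c) = lse z + ln (\sum_i softmax z i * expR (c ord0 i)).
Proof.
have E : \sum_i expR ((z + c) ord0 i) =
    expR (lse z) * \sum_i softmax z i * expR (c ord0 i).
  rewrite mulr_sumr; apply: eq_bigr => i _.
  by rewrite mxE -!expRD; congr expR; ring.
have p0 : 0 < \sum_i softmax z i * expR (c ord0 i).
  by have := sum_expR_gt0 (z + c); rewrite E pmulr_rgt0// expR_gt0.
by rewrite /lse -/(lse z) E lnM ?posrE ?expR_gt0// expRK.
Qed.

(* Half the variance of [c] under [softmax z], that is half the second derivative of
   [lse] at [z] in the direction [c]. *)
Definition lvar c z : R :=
  4^-1 * \sum_i \sum_j (c ord0 i - c ord0 j) ^+ 2 * (softmax z i * softmax z j).

(** The pairwise form puts nonnegative weights on squared increments, so that a comparison of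
    increments acts term by term; the form on the right is the one that [ln_tilt] produces. *)
Lemma lvarE c z : lvar c z =
  2^-1 * (\sum_i softmax z i * c ord0 i ^+ 2 - (\sum_i softmax z i * c ord0 i) ^+ 2).
Proof.
set p := softmax z; set m := \sum_i p i * c ord0 i.
have p1 : \sum_i p i = 1 by exact: sum_softmax.
have inner i : \sum_j (c ord0 i - c ord0 j) ^+ 2 * (p i * p j) =
    p i * c ord0 i ^+ 2 - p i * c ord0 i * (2 * m) + p i * \sum_j p j * c ord0 j ^+ 2.
  transitivity (\sum_j (p j * (p i * c ord0 i ^+ 2) - p j * c ord0 j * (p i * c ord0 i * 2) + p j * c ord0 j ^+ 2 * p i)).
    by apply: eq_bigr => j _; ring.
  by rewrite big_split sumrB /= -!mulr_suml p1 -/m; ring.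
rewrite /lvar; under eq_bigr do rewrite inner.
by rewrite big_split sumrB /= -!mulr_suml p1 -/m; field.
Qed.

Lemma lvarZ h c z : lvar (h *: c) z = h ^+ 2 * lvar c z.
Proof.
rewrite /lvar mulrCA; congr (_ * _); rewrite mulr_sumr; apply: eq_bigr => i _.
by rewrite mulr_sumr; apply: eq_bigr => j _; rewrite !mxE; ring.
Qed.

Lemma lse_expand z c (x : R) :
  `|lse (z + x *: c) - lse z - x * (\sum_i softmax z i * c ord0 i) - x ^+ 2 * lvar c z|
    <= 32 * `|c| ^+ 3 * `|x| ^+ 3.
Proof.
rewrite lse_shift -lvarZ lvarE.
have -> : x * (\sum_i softmax z i * c ord0 i) = \sum_i softmax z i * (x *: c) ord0 i.
  by rewrite mulr_sumr; apply: eq_bigr => i _; rewrite mxE mulrCA.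
rewrite [lse z + _]addrC addrK -mulrA -exprMn [`|c| * _]mulrC -normrZ.
apply: ln_tilt.
- exact: softmax_ge0.
- exact: sum_softmax.
- exact: normr_ge0.
- by move=> i; exact: coord_le_mx_norm.
have := sum_expR_gt0 (z + x *: c); rewrite -expR_lse lse_shift.
set S := \sum_i _ => _; rewrite /S big_ord_recl ltr_pwDl//.
  by rewrite mulr_gt0// expR_gt0.
by apply: sumr_ge0 => i _; rewrite mulr_ge0// expR_ge0.
Qed.

Lemma softmax_lip i : lip 2 (softmax^~ i).
Proof.
split=> // x y.
suff H (a b : 'rV[R]_n.+1) : softmax a i - softmax b i <= 2 * `|a - b|.
  by rewrite ler_norml lerNl opprB; apply/andP; split; [rewrite distrC; exact: H|exact: H].
have h1 : (a ord0 i - lse a) - (b ord0 i - lse b) <= 2 * `|a - b|.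
  have l1 : lse b - lse a <= `|a - b|.
    apply: le_trans (ler_norm _) _; rewrite [leRHS]distrC -[leRHS]mul1r.
    exact: lse_lip.2.
  have l2 : a ord0 i - b ord0 i <= `|a - b|.
    apply: le_trans (ler_norm _) _.
    by have := coord_le_mx_norm (a - b) ord0 i; rewrite !mxE.
  rewrite opprB [lse b - _]addrC addrACA [- lse a + _]addrC; apply: le_trans (lerD l2 l1) _.
  by rewrite mulr_natl mulr2n.
by apply: expR_dist_le h1; rewrite ?subr_le0 ?coord_le_lse ?mulr_ge0.
Qed.

(** Of the (n + 1)^2 pairs, each has a squared increment of at most 4 |c|^2 and a product of two
    [softmax] values that is 4-Lipschitz; the prefactor is 1/4. *)
Lemma lvar_lip c : lip (4 * n.+1%:R ^+ 2 * `|c| ^+ 2) (lvar c).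
Proof.
have bd i j : (c ord0 i - c ord0 j) ^+ 2 <= 4 * `|c| ^+ 2.
  rewrite (_ : 4 * _ = (2 * `|c|) ^+ 2); last ring.
  rewrite -[leLHS]real_normK ?num_real// lerXn2r ?nnegrE ?mulr_ge0//.
  apply: le_trans (ler_normB _ _) _.
  by have := coord_le_mx_norm c ord0 i; have := coord_le_mx_norm c ord0 j; lra.
split=> [|x y]; first by rewrite !mulr_ge0// exprn_ge0.
rewrite /lvar -mulrBr normrM ger0_norm// -sumrB.
have -> : 4 * n.+1%:R ^+ 2 * `|c| ^+ 2 * `|x - y| =
    4^-1 * \sum_(i < n.+1) \sum_(j < n.+1) (4 * `|c| ^+ 2) * (4 * `|x - y|).
  set K := _ * (4 * _); rewrite !sumr_const !card_ord.
  by rewrite -(mulr_natr (K *+ n.+1)) -(mulr_natr K) /K; field.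
rewrite ler_wpM2l//; apply: le_trans (ler_norm_sum _ _ _) _; apply: ler_sum => i _.
rewrite -sumrB; apply: le_trans (ler_norm_sum _ _ _) _; apply: ler_sum => j _.
rewrite -mulrBr normrM (ger0_norm (sqr_ge0 _)) ler_pM ?sqr_ge0//.
apply: le_trans (prod_dist _ _ _ _ _ _) _.
- by rewrite softmax_ge0 softmax_le1.
- by rewrite softmax_ge0 softmax_le1.
rewrite (_ : 4 = 2 + 2 :> R); last by rewrite -natrD.
by rewrite mulrDl lerD//; exact: (softmax_lip _).2.
Qed.

End log_sum_exp.

(** * Gaussian comparison *)

Lemma gavg_dist {R : realType} {V : normedModType R} (c : V) (f : V -> R) (L : R) (z : V) :
  lip L f ->
  `|gavg c f z - f z| <= L * `|c| * \int[normal_prob 0 1]_x (`|x| : R).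
Proof.
move=> Hf; have hz := avg_integrable _ c f L z normal_integrable_id Hf.
have hc := prob_integrable_cst (@normal_prob R 0 1) (f z).
have -> : gavg c f z - f z = \int[normal_prob 0 1]_x (f (z + x *: c) - f z).
  by rewrite RintegralB// Rintegral_prob_cst.
have iB := integrable_subr hz hc.
apply: le_trans (le_normr_Rintegral _ _) _ => //.
rewrite -RintegralZl//; last exact: (integrable_normal_norm_exp R 1).
apply: le_Rintegral => //; first exact: (integrable_abse iB).
  by apply: integrable_scaler; exact: (integrable_normal_norm_exp R 1).
move=> x _; have := lip_line z c x 0 Hf.
by rewrite scale0r addr0 subr0.
Qed.

Section lindeberg.
Context {R : realType} {n : nat}.
Implicit Types (z c : 'rV[R]_n.+1) (cs bs : seq 'rV[R]_n.+1).

Let m1 : R := \int[normal_prob 0 1]_x `|x|.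
Let m3 : R := \int[normal_prob 0 1]_x (`|x| ^+ 3).

Let m1_ge0 : 0 <= m1. Proof. exact: Rintegral_ge0. Qed.
Let m3_ge0 : 0 <= m3.
Proof. by apply: Rintegral_ge0 => x _; exact: exprn_ge0. Qed.

(** In [lse_expand] the linear term has mean 0, the quadratic one contributes the second moment, and
    the cubic error the third absolute moment. *)
Lemma gavg_lse z c :
  `|gavg c lse z - (lse z + normal_m2 R * lvar c z)| <= 32 * m3 * `|c| ^+ 3.
Proof.
set P := @normal_prob R 0 1.
have hz := avg_integrable _ c lse 1 z normal_integrable_id lse_lip.
have h0 := prob_integrable_cst P (lse z).
set a := \sum_i softmax z i * c ord0 i; set q := lvar c z.
have hid := integrable_normal_id R; have hsq := integrable_normal_sqr R.
have h1 := integrable_scaler a hid; have h2 := integrable_scaler q hsq.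
have h01 := integrable_addr h0 h1; have h012 := integrable_addr h01 h2.
have -> : lse z + normal_m2 R * q =
    \int[P]_x (lse z + a * x + q * x ^+ 2).
  rewrite RintegralD// RintegralD// Rintegral_prob_cst !RintegralZl//.
  by rewrite normal_mean mulr0 addr0 mulrC.
rewrite /gavg /avg -RintegralB//.
have iB := integrable_subr hz h012.
apply: le_trans (le_normr_Rintegral _ _) _ => //.
rewrite mulrAC -RintegralZl//; last exact: (integrable_normal_norm_exp R 3).
apply: le_Rintegral => //; first exact: (integrable_abse iB).
  by apply: integrable_scaler; exact: (integrable_normal_norm_exp R 3).
move=> x _; have := lse_expand z c x.
by rewrite -/a -/q [x * a]mulrC [x ^+ 2 * q]mulrC !opprD !addrA.
Qed.

(** [K] is uniform over lists of a given length, so it survives the rescaling of the vectors that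
    makes [D] small. In the induction the [lvar] terms of the tail are evaluated at a displaced
    point; their Lipschitz constant is of order D^2 and the displacement of order D, so this error
    is cubic as well. *)
Lemma gavgs_lse (k : nat) : exists2 K : R, 0 <= K &
  forall cs (D : R), size cs = k -> 0 <= D -> (forall c, c \in cs -> `|c| <= D) ->
  forall z, `|gavgs cs lse z - (lse z + normal_m2 R * \sum_(c <- cs) lvar c z)| <= K * D ^+ 3.
Proof.
elim: k => [|k [K K0 IH]].
  exists 0 => // -[]// D _ _ _ z /=.
  by rewrite big_nil mulr0 addr0 subrr normr0 mul0r.
set m2 := normal_m2 R in IH *; have m20 : 0 <= m2 := normal_m2_ge0 R.
pose N : R := 4 * n.+1%:R ^+ 2; have N0 : 0 <= N by rewrite mulr_ge0// exprn_ge0.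
exists (K + 32 * m3 + m2 * (k%:R * N) * m1); first by rewrite !addr_ge0// !mulr_ge0.
case=> // c cs D [sk] D0 cD z /=.
have cD' c' : c' \in cs -> `|c'| <= D by move=> h; apply: cD; rewrite inE h orbT.
have cD0 : `|c| <= D by apply: cD; rewrite inE eqxx.
pose Q z := \sum_(c' <- cs) lvar c' z.
have Qlip : lip (k%:R * N * D ^+ 2) Q.
  split=> [|x y]; first by rewrite !mulr_ge0// exprn_ge0.
  rewrite /Q -sumrB; apply: le_trans (ler_norm_sum _ _ _) _.
  have -> : k%:R * N * D ^+ 2 * `|x - y| = \sum_(c' <- cs) N * D ^+ 2 * `|x - y|.
    by rewrite big_const_seq count_predT sk iter_addr addr0 -!mulrA mulr_natl.
  rewrite big_seq [leRHS]big_seq; apply: ler_sum => c' c'cs.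
  apply: le_trans ((lvar_lip c').2 x y) _; rewrite ler_wpM2r// ler_wpM2l//.
  by rewrite lerXn2r ?nnegrE// cD'.
pose G z := lse z + m2 * Q z.
have Glip := lipD lse_lip (lipZ m2 Qlip).
have s1 : `|gavg c (gavgs cs lse) z - gavg c G z| <= K * D ^+ 3.
  apply: (avg_dist _ normal_integrable_id _ _ _ _ _ _ _ (gavgs_lip cs lse_lip) Glip).
  exact: IH.
have s2 : gavg c G z = gavg c lse z + m2 * gavg c Q z.
  rewrite -(avgZ _ normal_integrable_id _ _ _ _ _ Qlip).
  exact: (avgD _ normal_integrable_id _ _ _ _ _ _ lse_lip (lipZ m2 Qlip)).
have s3 := gavg_lse z c.
have s4 := gavg_dist c Q _ z Qlip.
have s3' : 32 * m3 * `|c| ^+ 3 <= 32 * m3 * D ^+ 3.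
  by rewrite ler_wpM2l ?mulr_ge0// lerXn2r ?nnegrE.
have s4' : m2 * (k%:R * N * D ^+ 2 * `|c| * m1) <= m2 * (k%:R * N) * m1 * D ^+ 3.
  rewrite [leRHS](_ : _ = m2 * (k%:R * N * D ^+ 2 * D * m1)); last by ring.
  by rewrite ler_wpM2l// ler_wpM2r// ler_wpM2l// !mulr_ge0// exprn_ge0.
have s5 : `|m2 * (gavg c Q z - Q z)| <= m2 * (k%:R * N * D ^+ 2 * `|c| * m1).
  by rewrite normrM ger0_norm// ler_wpM2l.
rewrite big_cons -/(Q z).
have -> : gavg c (gavgs cs lse) z - (lse z + m2 * (lvar c z + Q z)) =
  (gavg c (gavgs cs lse) z - gavg c G z) + (gavg c lse z - (lse z + m2 * lvar c z))
   + m2 * (gavg c Q z - Q z).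
  by rewrite s2; ring.
apply: le_trans (ler_normD _ _) _; rewrite 2!mulrDl; apply: lerD.
  apply: le_trans (ler_normD _ _) _; apply: lerD => //.
  exact: le_trans s3 s3'.
exact: le_trans s5 s4'.
Qed.

End lindeberg.

(* By stability, averaging along [cs] is averaging twice along [r *: cs], and the two
   families of averages commute. *)
Lemma gavgs_double {R : realType} {V : normedModType R} (r : R) (bs cs : seq V)
    (f : V -> R) (L e : R) :
  0 < r -> r ^+ 2 + r ^+ 2 = 1 -> lip L f ->
  (forall z, gavgs [seq r *: c | c <- cs] f z <= gavgs [seq r *: b | b <- bs] f z + e) ->
  forall z, gavgs cs f z <= gavgs bs f z + 2 * e.
Proof.
move=> r0 r2 Hf H z.
rewrite -(gavgs_stable r r cs f L)// -(gavgs_stable r r bs f L)//.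
set rc := [seq _ | _ <- cs]; set rb := [seq _ | _ <- bs].
apply: (@le_trans _ _ (gavgs rc (gavgs rb f) z + e)).
  by apply: gavgs_le; [exact: gavgs_lip Hf|exact: gavgs_lip Hf|exact: H].
rewrite (gavgsC rc rb f L)// mulr_natl mulr2n addrA lerD2r.
by apply: gavgs_le; [exact: gavgs_lip Hf|exact: gavgs_lip Hf|exact: H].
Qed.

Lemma gavgs_double_iter {R : realType} {V : normedModType R} (r : R) (f : V -> R)
    (L : R) (k : nat) :
  0 < r -> r ^+ 2 + r ^+ 2 = 1 -> lip L f ->
  forall (bs cs : seq V) (e : R),
  (forall z, gavgs [seq r ^+ k *: c | c <- cs] f z <=
             gavgs [seq r ^+ k *: b | b <- bs] f z + e) ->
  forall z, gavgs cs f z <= gavgs bs f z + 2 ^+ k * e.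
Proof.
move=> r0 r2 Hf; elim: k => [|k IH] bs cs e H.
  move=> z; have := H z.
  by rewrite expr0 mul1r !(eq_map (@scale1r _ _)) !map_id.
rewrite exprSr -mulrA; apply: IH; apply: (gavgs_double r _ _ _ L) => // z.
have E (s : seq V) : [seq r *: c | c <- [seq r ^+ k *: c | c <- s]] =
    [seq r ^+ k.+1 *: c | c <- s].
  by rewrite -map_comp; apply: eq_map => c /=; rewrite scalerA -exprS.
by rewrite !E.
Qed.

(* A list [cs] encodes the Gaussian vector [sum_c x_c c] with independent standard
   normal [x_c], so the two sides of the hypothesis are the variances of the increments. *)
Lemma sudakov_fernique {R : realType} {n : nat} (bs cs : seq 'rV[R]_n.+1) (z : 'rV[R]_n.+1) :
  (forall i j, \sum_(c <- cs) (c ord0 i - c ord0 j) ^+ 2 <=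
               \sum_(b <- bs) (b ord0 i - b ord0 j) ^+ 2) ->
  gavgs cs lse z <= gavgs bs lse z.
Proof.
move=> H.
have lvar_sum (s : seq 'rV[R]_n.+1) (h : R) y :
    \sum_(c <- [seq h *: c | c <- s]) lvar c y =
    h ^+ 2 * (4^-1 * \sum_i \sum_j (\sum_(c <- s) (c ord0 i - c ord0 j) ^+ 2) *
      (softmax y i * softmax y j)).
  rewrite big_map; under eq_bigr do rewrite lvarZ /lvar.
  rewrite -!mulr_sumr exchange_big; congr (_ * (_ * _)); apply: eq_bigr => i _.
  by rewrite exchange_big; apply: eq_bigr => j _; rewrite mulr_suml.
pose r : R := (Num.sqrt 2)^-1.
have s2 : Num.sqrt 2 ^+ 2 = 2 :> R by rewrite sqr_sqrtr.
have sp : 0 < Num.sqrt 2 :> R by rewrite sqrtr_gt0.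
have r0 : 0 < r by rewrite invr_gt0.
have r2 : r ^+ 2 = 2^-1 by rewrite exprVn s2.
have r1 : r < 1.
  rewrite invf_lt1// -(ltr_pXn2r (ltn0Sn 1)) ?nnegrE// ?ltW// s2 expr1n.
  by rewrite ltr1n.
have rr : r ^+ 2 + r ^+ 2 = 1 by rewrite r2; lra.
have [Kb Kb0 HKb] := @gavgs_lse R n (size bs).
have [Kc Kc0 HKc] := @gavgs_lse R n (size cs).
pose D : R := \sum_(c <- cs ++ bs) `|c|.
have D0 : 0 <= D by exact: sumr_ge0.
have cD c : c \in cs ++ bs -> `|c| <= D.
  by move=> hc; rewrite /D (big_rem c hc) lerDl; exact: sumr_ge0.
(* Each of the 2^k exchanges has an error cubic in r^k, and r^2 = 1/2 gives 2^k (r^k)^3 = r^k, which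
   tends to 0. *)
have step k : gavgs cs lse z <= gavgs bs lse z + ((Kb + Kc) * D ^+ 3) * r ^+ k.
  have -> : (Kb + Kc) * D ^+ 3 * r ^+ k = 2 ^+ k * ((Kb + Kc) * (r ^+ k * D) ^+ 3).
    have e : 2 ^+ k * (r ^+ k) ^+ 2 = 1.
      by rewrite exprAC r2 -exprMn divff// expr1n.
    move: e; move: (2 ^+ k) (r ^+ k) => t h e.
    by rewrite -[LHS]mul1r -[X in X * _]e; ring.
  apply: (gavgs_double_iter r _ 1 k r0 rr lse_lip) => y.
  set h := r ^+ k; have h0 : 0 <= h by rewrite exprn_ge0// ltW.
  have bound s : (forall c, c \in s -> c \in cs ++ bs) ->
      forall c, c \in [seq h *: c | c <- s] -> `|c| <= h * D.
    move=> sub c /mapP[c' c's ->]; rewrite normrZ ger0_norm// ler_wpM2l//.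
    by apply: cD; exact: sub.
  have hD : 0 <= h * D by exact: mulr_ge0.
  have Bb := HKb _ (h * D) (size_map _ _) hD (bound bs _) y.
  have Bc := HKc _ (h * D) (size_map _ _) hD (bound cs _) y.
  have sb c : c \in bs -> c \in cs ++ bs by rewrite mem_cat => ->; rewrite orbT.
  have sc c : c \in cs -> c \in cs ++ bs by rewrite mem_cat => ->.
  have le_var : normal_m2 R * \sum_(c <- [seq h *: c | c <- cs]) lvar c y <=
      normal_m2 R * \sum_(c <- [seq h *: c | c <- bs]) lvar c y.
    rewrite !lvar_sum ler_wpM2l ?normal_m2_ge0// ler_wpM2l ?sqr_ge0// ler_wpM2l//.
    apply: ler_sum => i _; apply: ler_sum => j _.
    by rewrite ler_wpM2r// mulr_ge0// softmax_ge0.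
  move: {Bb}(Bb sb) {Bc}(Bc sc) le_var; rewrite !ler_distl => /andP[+ _] /andP[_].
  move: (gavgs _ _ _) (gavgs _ _ _) (lse y) => u v w.
  move: (normal_m2 R * _) (normal_m2 R * _) ((h * D) ^+ 3) => q q' d.
  by rewrite mulrDl; lra.
rewrite leNgt; apply/negP => lt.
pose C := (Kb + Kc) * D ^+ 3.
have C0 : 0 <= C by rewrite mulr_ge0 ?addr_ge0 ?exprn_ge0.
have : (fun k => r ^+ k) @ \oo --> 0.
  by apply: cvg_expr; rewrite gtr0_norm.
have C1 : 0 < C + 1 by rewrite ltr_wpDl.
have e0 : 0 < (gavgs cs lse z - gavgs bs lse z) / (C + 1).
  by apply: divr_gt0; rewrite ?subr_gt0.
move/cvgrPdist_lt => /(_ _ e0) [k _ /(_ k (leqnn k))] /=.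
rewrite sub0r normrN gtr0_norm ?exprn_gt0// ltr_pdivlMr// => hk.
have := step k; rewrite -/C.
have : 0 < r ^+ k by rewrite exprn_gt0.
move: hk lt; move: (gavgs _ _ _) (gavgs _ _ _) (r ^+ k) => u v h.
by rewrite mulrDr mulr1 [h * C]mulrC; lra.
Qed.

(** A quadratic majorant in independent standard normal coordinates is integrated one coordinate at
    a time, each square having mean at most 1. *)
Lemma gavgs_quad_le {R : realType} {V : normedModType R} (I : eqType) (s : seq I)
    (b : I -> V) (k : I -> R) (f : V -> R) (L : R) :
  lip L f -> uniq s -> (forall i, 0 <= k i) ->
  forall (z : V) (K : R),
  (forall x : I -> R, f (z + \sum_(i <- s) x i *: b i) <= K + \sum_(i <- s) k i * x i ^+ 2) ->
  gavgs [seq b i | i <- s] f z <= K + \sum_(i <- s) k i.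
Proof.
move=> Hf us k0; elim: s us => [_ z K H|i s IH /= /andP[ins us] z K H].
  by have := H (fun=> 0); rewrite !big_nil !addr0.
rewrite big_cons.
have P1 x : gavgs [seq b i | i <- s] f (z + x *: b i) <= K + k i * x ^+ 2 + \sum_(i <- s) k i.
  apply: IH => // y.
  (* Coordinate [i] is frozen at [x]; since [i] does not occur in [s], the other coordinates are
     unaffected. *)
  have := H (fun j => if j == i then x else y j).
  rewrite !big_cons eqxx !addrA.
  have E (j : I) : j \in s -> (if j == i then x else y j) = y j.
    by move=> js; rewrite ifN//; apply: contraNneq ins => <-.
  under eq_big_seq => j js do rewrite E//.
  by under [X in _ <= _ + X]eq_big_seq => j js do rewrite E//.
have hz := avg_integrable _ (b i) _ L z normal_integrable_id (gavgs_lip [seq b i | i <- s] Hf).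
have hsq := integrable_normal_sqr R.
have hc := prob_integrable_cst (@normal_prob R 0 1) (K + \sum_(i <- s) k i).
apply: (@le_trans _ _ (\int[normal_prob 0 1]_x ((K + \sum_(i <- s) k i) + k i * x ^+ 2))).
  apply: le_Rintegral => //; first exact: (integrable_addr hc (integrable_scaler _ hsq)).
  by move=> x _; have := P1 x; lra.
rewrite RintegralD//; last exact: integrable_scaler.
rewrite Rintegral_prob_cst RintegralZl//.
have := ler_wpM2l (k0 i) (normal_m2_le1 R); rewrite /normal_m2; lra.
Qed.

(** * Independent random variables *)

Section independent_average.
Context {d : measure_display} {T : measurableType d} {R : realType}.
Context (P : probability T R) {I : eqType} (X : I -> T -> R)
  (mu : I -> probability (measurableTypeR R) R)
  (mX : forall i, measurable_fun [set: T] (X i)).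

Fixpoint cylinder (B : I -> set R) (s : seq I) : set T :=
  if s is i :: s' then X i @^-1` B i `&` cylinder B s' else setT.

Definition has_law i : Prop :=
  forall V : set R, measurable V -> P (X i @^-1` V) = mu i V.

(** Combines the laws of the coordinates in [s] with their joint independence from each other and
    from [E]. By [indep_event_cons] the property passes to the tail of [s] when a condition on the
    head is added to [E], as an induction on [s] requires. *)
Definition indep_event (E : set T) (s : seq I) : Prop :=
  forall B : I -> set R, (forall i, measurable (B i)) ->
  P (E `&` cylinder B s) = (P E * \prod_(i <- s) mu i (B i))%E.

Lemma ge0_integral_law i (h : R -> R) : has_law i ->
  measurable_fun [set: R] h -> (forall x, 0 <= h x) ->
  (\int[P]_w (h (X i w))%:E = \int[mu i]_x (h x)%:E)%E.
Proof.
move=> law mh h0.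
have mX' : @measurable_fun _ _ T (measurableTypeR R) [set: T] (X i) by exact: mX.
have mh' : measurable_fun [set: measurableTypeR R] (EFin \o h) by exact/measurable_EFinP.
rewrite -(@eq_measure_integral _ _ _ setT (mu i) (pushforward P (X i : T -> measurableTypeR R))).
  by rewrite (ge0_integral_pushforward mX' P measurableT mh')// => x _; rewrite lee_fin.
by move=> A mA _; exact: law.
Qed.

Lemma integrable_law i (h : R -> R) : has_law i ->
  measurable_fun [set: R] h -> (mu i).-integrable [set: R] (EFin \o h) ->
  P.-integrable [set: T] (EFin \o (h \o X i)).
Proof.
move=> law mh /integrableP[_ ih]; apply/integrableP; split.
  by apply/measurable_EFinP; exact: measurableT_comp.
have := ge0_integral_law i (fun x => `|h x|) law.
rewrite /= => ->//; apply: measurableT_comp => //; exact: normr_measurable.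
Qed.

Lemma eq_cylinder B B' s : {in s, B =1 B'} -> cylinder B s = cylinder B' s.
Proof.
elim: s => //= i s IH H; rewrite (H i) ?inE ?eqxx// IH// => j js.
by apply: H; rewrite inE js orbT.
Qed.

Lemma indep_event_cons E i s (V : set R) : has_law i -> i \notin s ->
  measurable V -> indep_event E (i :: s) ->
  P (E `&` X i @^-1` V) = (P E * mu i V)%E /\ indep_event (E `&` X i @^-1` V) s.
Proof.
move=> law ins mV H.
have eqB B j : j \in s -> (if j == i then V else B j) = B j.
  by move=> js; rewrite ifN//; apply: contraNneq ins => <-.
have cylT : cylinder (fun=> setT) s = setT.
  by elim: s {ins H eqB} => //= j s ->; rewrite setIT preimage_setT.
have e1 : P (E `&` X i @^-1` V) = (P E * mu i V)%E.
  have := H (fun j => if j == i then V else setT).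
  rewrite /= eqxx big_cons eqxx (eq_cylinder _ (fun=> setT)) => [|j js]; last exact: (eqB (fun=> setT)).
  rewrite cylT setIT => ->; last by move=> j; case: ifP.
  rewrite big_seq big1 ?mule1// => j js; rewrite (eqB (fun=> setT))//.
  exact: probability_setT.
split=> // B mB.
have := H (fun j => if j == i then V else B j).
rewrite /= eqxx big_cons eqxx (eq_cylinder _ B) => [|j js]; last exact: eqB.
rewrite setIA => ->; last by move=> j; case: ifP.
rewrite e1 -muleA; congr (_ * (_ * _))%E; apply: eq_big_seq => j js.
by rewrite eqB.
Qed.

(** [V] carries no sigma-algebra, so the measurability of the composite is assumed; for [lse] it is
    checked coordinatewise. *)
Context {V : normedModType R} (c : I -> V) (f : V -> R) (L : R) (Hf : lip L f)
  (mf : forall z (s : seq I),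
    measurable_fun [set: T] (fun w => f (z + \sum_(i <- s) X i w *: c i)))
  (imu : forall i, (mu i).-integrable [set: R] (EFin \o id)).

Definition avgs (s : seq I) : V -> R := foldr (fun i => avg (mu i) (c i)) f s.

Lemma avgs_lip s : lip L (avgs s).
Proof. by elim: s => //= i s; exact: avg_lip. Qed.

Lemma integrable_lip_sum s z : (forall i, i \in s -> has_law i) ->
  P.-integrable [set: T] (EFin \o (fun w => f (z + \sum_(i <- s) X i w *: c i))).
Proof.
move=> law.
have iX i : i \in s -> P.-integrable [set: T] (EFin \o X i).
  by move=> /law li; exact: (integrable_law i id li).
have ig : P.-integrable [set: T] (EFin \o (fun w => `|f z| + L * \sum_(i <- s) `|c i| * `|X i w|)).
  apply: integrable_addr; first exact: prob_integrable_cst.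
  apply: integrable_scaler; elim: s {law} iX => [|i s IH] iX.
    by under eq_fun do rewrite big_nil; exact: prob_integrable_cst.
  rewrite (_ : (fun w => _) = fun w => `|c i| * `|X i w| + \sum_(i <- s) `|c i| * `|X i w|); last first.
    by apply/funext => w; rewrite big_cons.
  apply: integrable_addr; last by apply: IH => j js; apply: iX; rewrite inE js orbT.
  by apply: integrable_scaler; apply: (integrable_abse (iX i _)); rewrite inE eqxx.
apply: (le_integrable _ _ _ ig) => //; first exact/measurable_EFinP.
move=> w _; rewrite /= lee_fin; case: Hf => L0 H.
rewrite [leRHS]ger0_norm; last first.
  by rewrite addr_ge0// mulr_ge0// sumr_ge0// => i _; rewrite mulr_ge0.
rewrite -[X in `|X|](subrK (f z)) addrC.
apply: le_trans (ler_normD _ _) _; rewrite lerD2l.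
apply: le_trans (H _ _) _; rewrite ler_wpM2l// addrC addKr.
apply: le_trans (ler_norm_sum _ _ _) _; apply: ler_sum => i _.
by rewrite normrZ mulrC.
Qed.

Lemma integrable_indicM E (h : T -> R) : measurable E ->
  P.-integrable [set: T] (EFin \o h) ->
  P.-integrable [set: T] (EFin \o (fun w => \1_E w * h w)).
Proof.
move=> mE ih; apply: (le_integrable _ _ _ ih) => //.
  apply/measurable_EFinP; apply: measurable_funM; first exact: measurable_indic.
  by apply/measurable_EFinP; exact: measurable_int ih.
move=> w _; rewrite /= lee_fin normrM ler_piMl// indicE.
by case: (_ \in _); rewrite ?normr1 ?normr0.
Qed.

(* The event [E] carries the values of the coordinates that have already been
   discretized. *)
Lemma Rintegral_avgs s E z : uniq s -> measurable E ->
  (forall i, i \in s -> has_law i) -> indep_event E s ->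
  \int[P]_w (\1_E w * f (z + \sum_(i <- s) X i w *: c i)) = fine (P E) * avgs s z.
Proof.
elim: s E z => [|i s IH] E z us mE law ind.
  under eq_Rintegral do rewrite big_nil addr0 mulrC.
  rewrite RintegralZl//; last exact: integrable_indic.
  by rewrite mulrC /Rintegral integral_indic// setIT.
move: us => /= /andP[ins us].
have li : has_law i by apply: law; rewrite inE eqxx.
have law' j : j \in s -> has_law j by move=> js; apply: law; rewrite inE js orbT.
apply: (eq_of_dist_le _ _ (2 * (L * `|c i|))) => e e0.
have [g [S [mg uS gS ge]]] := L1_simple (mu i) e e0 (imu i).
have mgy y : @measurable _ (measurableTypeR R) (g @^-1` [set y]).
  by rewrite -[X in measurable X]setTI; exact: mg.
(* On [Ey y] the discretized head coordinate equals [y], so the induction hypothesis applies with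
   this event and the base point [z + y *: c i]. *)
pose Ey y := E `&` X i @^-1` (g @^-1` [set y]).
have mEy y : measurable (Ey y).
  by apply: measurableI => //; rewrite -[X in measurable X]setTI; apply: (mX i measurableT); exact: mgy.
pose Y w := z + X i w *: c i + \sum_(j <- s) X j w *: c j.
pose Y' w := z + g (X i w) *: c i + \sum_(j <- s) X j w *: c j.
have iY : P.-integrable [set: T] (EFin \o (fun w => \1_E w * f (Y w))).
  apply: integrable_indicM => //.
  have := integrable_lip_sum (i :: s) z law.
  by under eq_fun do rewrite big_cons addrA.
have Y'E w : \1_E w * f (Y' w) =
    \sum_(y <- S) \1_(Ey y) w * f (z + y *: c i + \sum_(j <- s) X j w *: c j).
  rewrite /Y' (finite_range_decomp (g \o X i) S (fun y => f (z + y *: c i + \sum_(j <- s) X j w *: c j)) w uS (gS _)).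
  rewrite mulr_sumr; apply: eq_bigr => y _; rewrite /Ey indicI/=.
  by rewrite mulrC -mulrA [RHS]mulrC; congr (_ * _); rewrite mulrC.
have iy y : P.-integrable [set: T]
    (EFin \o (fun w => \1_(Ey y) w * f (z + y *: c i + \sum_(j <- s) X j w *: c j))).
  by apply: integrable_indicM => //; exact: integrable_lip_sum.
have iY' : P.-integrable [set: T] (EFin \o (fun w => \1_E w * f (Y' w))).
  under eq_fun do rewrite Y'E; exact: integrable_sumr.
have int' : \int[P]_w (\1_E w * f (Y' w)) =
    fine (P E) * \sum_(y <- S) fine (mu i (g @^-1` [set y])) * avgs s (z + y *: c i).
  under eq_Rintegral do rewrite Y'E.
  rewrite mulr_sumr; elim: S {uS gS Y'E iY' ge} => [|y S IHS].
    by rewrite big_nil; under eq_Rintegral do rewrite big_nil; rewrite Rintegral_prob_cst.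
  rewrite big_cons -IHS; under eq_Rintegral do rewrite big_cons.
  rewrite RintegralD//; last exact: integrable_sumr.
  congr (_ + _).
  have [Pe ie] := indep_event_cons E i s (g @^-1` [set y]) li ins (mgy y) ind.
  rewrite IH// Pe fineM ?fin_num_measure// ?mulrA//.
(* The discretization is paid for twice, each time with at most L |c i| e: here under [P], and in
   [h2] under the law [mu i]. *)
have h1 : `|\int[P]_w (\1_E w * f (Y w)) - \int[P]_w (\1_E w * f (Y' w))| <= L * `|c i| * e.
  rewrite -RintegralB//.
  have mxg : measurable_fun [set: R] (fun x => `|x - g x|).
    apply: measurableT_comp; first exact: normr_measurable.
    exact: measurable_funB.
  have ixg : P.-integrable [set: T] (EFin \o (fun w => `|X i w - g (X i w)|)).
    apply: (integrable_law i (fun x => `|x - g x|) li mxg).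
    have ig : (mu i).-integrable [set: R] (EFin \o g).
      rewrite (_ : EFin \o _ = EFin \o (fun x => \sum_(y <- S) y * \1_(g @^-1` [set y]) x)).
        apply: integrable_sumr => y; apply: integrable_scaler.
        exact: (integrable_indic (mu i) (mgy y)).
      apply/funext => x /=; congr EFin.
      exact: (finite_range_decomp g S id x uS (gS x)).
    exact: (integrable_abse (integrable_subr (imu i) ig)).
  apply: (@le_trans _ _ (\int[P]_w (L * `|c i| * `|X i w - g (X i w)|))).
    apply: le_trans (le_normr_Rintegral _ _) _ => //; first exact: integrable_subr.
    apply: le_Rintegral => //; first exact: (integrable_abse (integrable_subr iY iY')).
      exact: integrable_scaler.
    move=> w _; rewrite -mulrBr normrM.
    apply: (@le_trans _ _ (`|f (Y w) - f (Y' w)|)).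
      by rewrite ler_piMl// indicE; case: (_ \in _); rewrite ?normr1 ?normr0.
    rewrite /Y /Y' (addrAC z (X i w *: _)) (addrAC z (g (X i w) *: _)).
    exact: lip_line.
  rewrite RintegralZl// ler_wpM2l ?mulr_ge0//; first by case: Hf.
  by rewrite {1}/Rintegral (ge0_integral_law i (fun x => `|x - g x|) li mxg).
have h2 := avg_simple (mu i) e g S (imu i) mg uS gS ge V (c i) (avgs s) L (avgs_lip s) z.
have -> : \int[P]_w (\1_E w * f (z + \sum_(j <- i :: s) X j w *: c j)) =
    \int[P]_w (\1_E w * f (Y w)).
  by apply: eq_Rintegral => w _; rewrite big_cons addrA.
rewrite int' in h1.
rewrite /= -/(avgs s); set A := avg _ _ _ _ in h2 *; set B := \sum_(y <- S) _ in h1 h2.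
have Pe01 : `|fine (P E)| <= 1.
  rewrite ger0_norm ?fine_ge0//.
  by rewrite -[leRHS]/(fine 1%:E) fine_le ?fin_num_measure//; exact: probability_le1.
have -> : \int[P]_w (\1_E w * f (Y w)) - fine (P E) * A =
    (\int[P]_w (\1_E w * f (Y w)) - fine (P E) * B) - fine (P E) * (A - B) by ring.
apply: le_trans (ler_normB _ _) _; rewrite -mulrA mulr_natl mulr2n.
apply: lerD => //; rewrite normrM -[leRHS]mul1r.
by apply: ler_pM.
Qed.

End independent_average.

(** * Gaussian tensors *)

Definition tensor_entry {E : Type} {m n : nat} (A : tensor E m n) (t : tensor_index m n) : E :=
  let: (i, j, k, l) := t in A i j k l.

Definition tensor_class {m n : nat} (t : tensor_index m n) : {set tensor_index m n} :=
  let: (i, j, k, l) := t in Pi_class i j k l.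

(* The representative of the class of [t] that lies in [free_index]. *)
Definition sort_index {m n : nat} (t : tensor_index m n) : tensor_index m n :=
  let: (i, j, k, l) := t in
  if (i <= k)%N then (if (j <= l)%N then (i, j, k, l) else (i, l, k, j))
  else (if (j <= l)%N then (k, j, i, l) else (k, l, i, j)).

Lemma sort_index_free {m n : nat} (t : tensor_index m n) :
  sort_index t \in free_index m n.
Proof.
case: t => [[[i j] k] l] /=; rewrite inE.
by case: (leqP i k) => ik; case: (leqP j l) => jl; rewrite ?ik ?jl ?(ltnW ik) ?(ltnW jl).
Qed.

(** Identifies the fibres of [sort_index] over free indices with the classes, so that a sum over all
    indices can be grouped by class. *)
Lemma sort_index_class {m n : nat} (t t' : tensor_index m n) :
  t' \in free_index m n -> (sort_index t == t') = (t \in tensor_class t').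
Proof.
case: t t' => [[[i j] k] l] [[[i' j'] k'] l']; rewrite !inE /= => /andP[ik jl].
apply/eqP/idP.
  by case: (leqP i k) => _; case: (leqP j l) => _ [<- <- <- <-]; rewrite eqxx ?orbT.
(* A class of fewer than four tuples comes from a tie i' = k' or j' = l'; in a tie [sort_index]
   performs no swap, yet the result is the same tuple. *)
have aik : (k' <= i')%N -> i' = k' by move=> h; apply/val_inj/eqP; rewrite eqn_leq ik.
have ajl : (l' <= j')%N -> j' = l' by move=> h; apply/val_inj/eqP; rewrite eqn_leq jl.
case/orP=> [/orP[/orP[]|]|] /eqP[-> -> -> ->]; rewrite ?ik ?jl//.
- by case: leqP => [/aik ->|]; rewrite ?ik ?jl.
- by case: leqP => [/ajl ->|]; rewrite ?ik ?jl.
- by case: leqP => [/aik ->|_]; case: leqP => [/ajl ->|_].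
Qed.

Lemma tensor_class_gt0 {m n : nat} (t : tensor_index m n) : (0 < #|tensor_class t|)%N.
Proof.
case: t => [[[i j] k] l]; apply/card_gt0P; exists (i, j, k, l).
by rewrite !inE eqxx.
Qed.

Lemma class_sum {R : realType} {m n : nat} (F : tensor R m n) :
  partially_symmetric F ->
  \sum_i \sum_k \sum_j \sum_l F i j k l =
  \sum_(t in free_index m n) #|tensor_class t|%:R * tensor_entry F t.
Proof.
move=> symF.
have -> : \sum_i \sum_k \sum_j \sum_l F i j k l = \sum_t tensor_entry F t.
  under eq_bigr do rewrite exchange_big.
  rewrite pair_bigA pair_bigA pair_bigA /=.
  by apply: eq_bigr => -[[[i j] k] l].
rewrite (partition_big sort_index (mem (free_index m n))) => [|t _]; last first.
  exact: sort_index_free.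
apply: eq_bigr => t' ft'.
rewrite (eq_bigl (mem (tensor_class t'))) => [|t]; last exact: sort_index_class.
rewrite (eq_bigr (fun=> tensor_entry F t')) => [|t].
  by rewrite sumr_const mulr_natl.
rewrite /= -sort_index_class// => /eqP <-.
case: t => [[[i j] k] l] /=; have [h1 h2 h3] := symF i k j l.
by case: leqP => _; case: leqP.
Qed.

Lemma normal_scale_integrable_id {R : realType} (s : R) : 0 < s ->
  (normal_prob 0 s).-integrable [set: R] (EFin \o id).
Proof.
move=> s0; apply/integrableP; split; first exact/measurable_EFinP.
have cn : continuous (fun x : R => `|x|) by exact: norm_continuous.
rewrite (integral_normal_prob_affine _ _ _ _ s0 cn)//.
have /integrableP[_] := integrable_scaler s (integrable_normal_id R).
by under eq_integral do rewrite /= -[X in `|X|]add0r.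
Qed.

Lemma avg_normal {R : realType} {V : normedModType R} (s : R) (c : V) (f : V -> R) (L : R) :
  0 < s -> lip L f -> avg (normal_prob 0 s) c f = gavg (s *: c) f.
Proof.
move=> s0 Hf; apply/funext => z; rewrite /gavg /avg.
pose h x := f (z + x *: c).
have Hh x y : `|h x - h y| <= L * `|c| * `|x - y| by exact: lip_line.
have ids := normal_scale_integrable_id s s0.
have id1 := @normal_integrable_id R.
pose lin (k : R -> R) := forall x y, `|k x - k y| <= L * `|c| * `|x - y|.
have idl (k : R -> R) : lin k -> (normal_prob 0 s).-integrable [set: R] (EFin \o k).
  by move=> Hk; exact: integrable_lipschitz_real ids Hk.
have idl1 (k : R -> R) : lin k ->
    (normal_prob 0 1).-integrable [set: R] (EFin \o (fun x => k (s * x))).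
  move=> Hk; apply: (integrable_lipschitz_real _ _ (L * `|c| * s) id1) => x y.
  apply: le_trans (Hk _ _) _.
  by rewrite -mulrBr normrM (gtr0_norm s0) mulrA.
have nn (k : R -> R) : (forall x, 0 <= k x) -> lin k ->
    \int[normal_prob 0 s]_x k x = \int[normal_prob 0 1]_x k (s * x).
  move=> k0 Hk; rewrite /Rintegral (integral_normal_prob_affine _ _ _ _ s0)//; last first.
    exact: lipschitz_real_continuous Hk.
  by congr fine; apply: eq_integral => x _; rewrite add0r.
have [hp [hm [hp0 hm0 linp linm hE]]] := lipschitz_pos_neg _ h Hh.
transitivity (\int[normal_prob 0 s]_x (hp x - hm x)).
  by apply: eq_Rintegral => x _; rewrite -hE.
rewrite RintegralB//; [|exact: idl|exact: idl].
rewrite (nn hp)// (nn hm)// -RintegralB//; [|exact: idl1|exact: idl1].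
by apply: eq_Rintegral => x _; rewrite -hE /h scalerA mulrC.
Qed.

(** * Unit vectors and increments of rank-one forms *)

Lemma enorm_sqr_sum {R : realType} {p : nat} (u : 'rV[R]_p) :
  enorm u = 1 -> \sum_i u ord0 i ^+ 2 = 1.
Proof.
move=> u1; have u0 : 0 <= \sum_i u ord0 i ^+ 2.
  by apply: sumr_ge0 => i _; exact: sqr_ge0.
by rewrite -[LHS]sqr_sqrtr// -/(enorm u) u1 expr1n.
Qed.

Definition dot {R : realType} {p : nat} (u v : 'rV[R]_p) : R :=
  \sum_i u ord0 i * v ord0 i.

Lemma sum_sqrB {R : realType} {p : nat} (u v : 'rV[R]_p) :
  enorm u = 1 -> enorm v = 1 ->
  \sum_i (u ord0 i - v ord0 i) ^+ 2 = 2 - 2 * dot u v.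
Proof.
move=> /enorm_sqr_sum u1 /enorm_sqr_sum v1.
transitivity (\sum_i (u ord0 i ^+ 2 + v ord0 i ^+ 2 - 2 * (u ord0 i * v ord0 i))).
  by apply: eq_bigr => i _; ring.
by rewrite sumrB big_split /= u1 v1 -mulr_sumr -/(dot u v).
Qed.

Lemma sum_sqrD {R : realType} {p : nat} (u v : 'rV[R]_p) :
  enorm u = 1 -> enorm v = 1 ->
  \sum_i (u ord0 i + v ord0 i) ^+ 2 = 2 + 2 * dot u v.
Proof.
move=> /enorm_sqr_sum u1 /enorm_sqr_sum v1.
transitivity (\sum_i (u ord0 i ^+ 2 + v ord0 i ^+ 2 + 2 * (u ord0 i * v ord0 i))).
  by apply: eq_bigr => i _; ring.
by rewrite big_split big_split /= u1 v1 -mulr_sumr -/(dot u v).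
Qed.

Lemma dot_itv {R : realType} {p : nat} (u v : 'rV[R]_p) :
  enorm u = 1 -> enorm v = 1 -> -1 <= dot u v <= 1.
Proof.
move=> u1 v1; have h1 := sum_sqrB u v u1 v1; have h2 := sum_sqrD u v u1 v1.
have p1 : 0 <= \sum_i (u ord0 i - v ord0 i) ^+ 2 by apply: sumr_ge0 => i _; exact: sqr_ge0.
have p2 : 0 <= \sum_i (u ord0 i + v ord0 i) ^+ 2 by apply: sumr_ge0 => i _; exact: sqr_ge0.
by apply/andP; split; lra.
Qed.

Definition rank_one {R : realType} {m n : nat} (u : 'rV[R]_m) (v : 'rV[R]_n) : tensor R m n :=
  fun i j k l => u ord0 i * v ord0 j * u ord0 k * v ord0 l.

Lemma rank_one_sym {R : realType} {m n : nat} (u : 'rV[R]_m) (v : 'rV[R]_n) :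
  partially_symmetric (rank_one u v).
Proof. by move=> i k j l; rewrite /rank_one; split; ring. Qed.

Lemma biquadraticE {R : realType} {m n : nat} (A : tensor R m n) u v :
  biquadratic A u v = \sum_i \sum_k \sum_j \sum_l A i j k l * rank_one u v i j k l.
Proof.
by do 4 (apply: eq_bigr => ? _); rewrite /rank_one !mulrA.
Qed.

Lemma biquadratic_free {R : realType} {m n : nat} (A : tensor R m n) u v :
  partially_symmetric A ->
  biquadratic A u v = \sum_(t in free_index m n)
    tensor_entry A t * (#|tensor_class t|%:R * tensor_entry (rank_one u v) t).
Proof.
move=> symA; rewrite biquadraticE.
rewrite (class_sum (fun i j k l => A i j k l * rank_one u v i j k l)).
  by apply: eq_bigr => -[[[i j] k] l] _ /=; rewrite mulrCA.
move=> i k j l; have [a1 a2 a3] := symA i k j l.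
by have [b1 b2 b3] := rank_one_sym u v i k j l; split; congr (_ * _).
Qed.

Lemma sum_rank_one_prod {R : realType} {m n : nat} (u u' : 'rV[R]_m) (v v' : 'rV[R]_n) :
  \sum_i \sum_k \sum_j \sum_l rank_one u v i j k l * rank_one u' v' i j k l =
  dot u u' ^+ 2 * dot v v' ^+ 2.
Proof.
have D (p : nat) (a : 'I_p -> R) : (\sum_i a i) ^+ 2 = \sum_i \sum_j a i * a j.
  by rewrite expr2 big_distrlr.
rewrite /dot !D mulr_suml; apply: eq_bigr => i _.
rewrite mulr_suml; apply: eq_bigr => k _; rewrite mulr_sumr; apply: eq_bigr => j _.
rewrite mulr_sumr; apply: eq_bigr => l _.
by rewrite /rank_one; ring.
Qed.

(** A free entry has variance 2 / card and coefficient card times the rank-one entry, which yields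
    the weight 2 card. By [class_sum] the sum unfolds to all indices, where the rank-one tensors
    have norm 1 and inner product s^2 t^2. *)
Lemma rank_one_dist {R : realType} {m n : nat} (u u' : 'rV[R]_m) (v v' : 'rV[R]_n) :
  enorm u = 1 -> enorm u' = 1 -> enorm v = 1 -> enorm v' = 1 ->
  \sum_(t in free_index m n) 2 * #|tensor_class t|%:R *
    (tensor_entry (rank_one u v) t - tensor_entry (rank_one u' v') t) ^+ 2 =
  4 * (1 - dot u u' ^+ 2 * dot v v' ^+ 2).
Proof.
move=> u1 u1' v1 v1'.
pose F : tensor R m n := fun i j k l => (rank_one u v i j k l - rank_one u' v' i j k l) ^+ 2.
transitivity (2 * \sum_(t in free_index m n) #|tensor_class t|%:R * tensor_entry F t).
  rewrite mulr_sumr; apply: eq_bigr => t _; rewrite mulrA; congr (_ * _).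
  by case: t => [[[i j] k] l].
rewrite -class_sum; last first.
  move=> i k j l; have [b1 b2 b3] := rank_one_sym u v i k j l.
  by have [c1 c2 c3] := rank_one_sym u' v' i k j l; split; rewrite /F; congr ((_ - _) ^+ 2).
have dd (p : nat) (w : 'rV[R]_p) : enorm w = 1 -> dot w w = 1.
  by move=> /enorm_sqr_sum <-; apply: eq_bigr => i _; rewrite expr2.
have e1 := sum_rank_one_prod u u v v; have e2 := sum_rank_one_prod u' u' v' v'.
have e3 := sum_rank_one_prod u u' v v'.
rewrite !dd// !expr1n mulr1 in e1 e2.
transitivity (2 * (\sum_i \sum_k \sum_j \sum_l rank_one u v i j k l * rank_one u v i j k l +
  \sum_i \sum_k \sum_j \sum_l rank_one u' v' i j k l * rank_one u' v' i j k l -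
  2 * (\sum_i \sum_k \sum_j \sum_l rank_one u v i j k l * rank_one u' v' i j k l))).
  congr (_ * _); rewrite mulr_sumr -big_split -sumrB; apply: eq_bigr => i _.
  rewrite mulr_sumr -big_split -sumrB; apply: eq_bigr => k _.
  rewrite mulr_sumr -big_split -sumrB; apply: eq_bigr => j _.
  rewrite mulr_sumr -big_split -sumrB; apply: eq_bigr => l _.
  by rewrite /F /=; ring.
by rewrite e1 e2 e3; ring.
Qed.

(** With a = 1 - s^2 and b = 1 - t^2 nonnegative, 1 - (1 - a) (1 - b) <= a + b, and a <= 2 (1 - s)
    because (1 - s)^2 >= 0. *)
Lemma sphere_increment_le {R : realType} (s t : R) : -1 <= s <= 1 -> -1 <= t <= 1 ->
  1 - s ^+ 2 * t ^+ 2 <= 2 * (1 - s) + 2 * (1 - t).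
Proof.
move=> /andP[s1 s2] /andP[t1 t2].
have h1 : 1 - s ^+ 2 <= 2 * (1 - s).
  by have := sqr_ge0 (1 - s); lra.
have h2 : 1 - t ^+ 2 <= 2 * (1 - t).
  by have := sqr_ge0 (1 - t); lra.
have h3 : 0 <= (1 - s ^+ 2) * (1 - t ^+ 2).
  rewrite (_ : _ * _ = ((1 - s) * (1 + s)) * ((1 - t) * (1 + t))); last by ring.
  by rewrite !mulr_ge0//; lra.
have : 1 - s ^+ 2 * t ^+ 2 = (1 - s ^+ 2) + (1 - t ^+ 2) - (1 - s ^+ 2) * (1 - t ^+ 2) by ring.
lra.
Qed.

(** * Expected log-sum-exp over finitely many points *)

Section finite_points.
Context {d : measure_display} {T : measurableType d} {R : realType}
  (P : probability T R) {m n : nat} (A : tensor {RV P >-> R} m n)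
  (hA : gaussian_random_tensor A).

Definition free_sigma (t : tensor_index m n) : R :=
  Num.sqrt (2 / #|tensor_class t|%:R).

Definition free_law (t : tensor_index m n) : probability (measurableTypeR R) R :=
  normal_prob 0 (free_sigma t).

Definition free_entry (t : tensor_index m n) : T -> R := tensor_entry A t.

Lemma free_sigma_gt0 t : 0 < free_sigma t.
Proof. by rewrite sqrtr_gt0 divr_gt0// ltr0n tensor_class_gt0. Qed.

Lemma free_sigma_sqr t : free_sigma t ^+ 2 = 2 / #|tensor_class t|%:R.
Proof. by rewrite sqr_sqrtr// divr_ge0. Qed.

Lemma free_entry_measurable t : measurable_fun [set: T] (free_entry t).
Proof. exact: measurable_funPT. Qed.

Lemma free_entry_law t : t \in enum (free_index m n) ->
  has_law P free_entry free_law t.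
Proof.
rewrite mem_enum; case: t => [[[i j] k] l]; rewrite inE => /andP[ik jl] V mV.
by have := gaussian_law hA ik jl mV.
Qed.

Lemma cylinder_bigcap (B : tensor_index m n -> set R) (s : seq (tensor_index m n)) :
  cylinder free_entry B s = \bigcap_(t in [set` s]) free_entry t @^-1` B t.
Proof.
elim: s => [|t s IH] /=.
  by rewrite (_ : [set` [::]] = set0) ?bigcap_set0//; apply/seteqP; split.
rewrite IH (_ : [set` t :: s] = t |` [set` s]) ?bigcap_setU1//.
apply/seteqP; split => x /=; rewrite in_cons.
  by case/orP => [/eqP ->|xs]; [left|right].
by case=> [->|xs]; rewrite ?eqxx// xs orbT.
Qed.

Lemma free_entry_indep : indep_event P free_entry free_law setT (enum (free_index m n)).
Proof.
move=> B mB; rewrite setTI probability_setT mul1e cylinder_bigcap.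
have := gaussian_independent hA (subxx (free_index m n)) mB.
rewrite (_ : [set` enum (free_index m n)] = [set` free_index m n]); last first.
  by apply/seteqP; split => t /=; rewrite mem_enum.
move=> e; apply: etrans (etrans e _) => //.
rewrite big_enum /=; apply: eq_bigr => t ft.
by apply: free_entry_law => //; rewrite mem_enum.
Qed.

Lemma free_entry_sort t w : free_entry (sort_index t) w = free_entry t w.
Proof.
case: t => [[[i j] k] l] /=; have [h1 h2 h3] := gaussian_symmetric hA w i k j l.
by case: leqP => _; case: leqP.
Qed.

(** The law is given for free indices; the other entries inherit integrability by symmetry. *)
Lemma free_entry_integrable t : P.-integrable [set: T] (EFin \o free_entry t).
Proof.
rewrite (_ : free_entry t = free_entry (sort_index t)); last first.
  by apply/funext => w; rewrite free_entry_sort.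
have law : has_law P free_entry free_law (sort_index t).
  by apply: free_entry_law; rewrite mem_enum; exact: sort_index_free.
apply: (integrable_law P free_entry free_law free_entry_measurable _ id law) => //.
exact: normal_scale_integrable_id (free_sigma_gt0 _).
Qed.

Context {M : nat} (u : 'I_M.+1 -> 'rV[R]_m) (v : 'I_M.+1 -> 'rV[R]_n) (beta : R)
  (u1 : forall p, enorm (u p) = 1) (v1 : forall p, enorm (v p) = 1)
  (beta0 : 0 < beta) (m0 : (0 < m)%N) (n0 : (0 < n)%N).

(* Coefficients of the free entries in [beta * biquadratic]; the factor [#|tensor_class t|]
   counts the equal entries of a class. *)
Definition coef (t : tensor_index m n) : 'rV[R]_M.+1 :=
  \row_p (beta * (#|tensor_class t|%:R * tensor_entry (rank_one (u p) (v p)) t)).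

Definition form_values (w : T) : 'rV[R]_M.+1 :=
  \row_p (beta * biquadratic (fun i j k l => A i j k l w) (u p) (v p)).

(* Coefficients of [2 beta (g . u_p + h . v_p)] with independent standard normal [g], [h]. *)
Definition comparison_coef (a : 'I_m + 'I_n) : 'rV[R]_M.+1 :=
  match a with
  | inl i => \row_p (2 * beta * u p ord0 i)
  | inr j => \row_p (2 * beta * v p ord0 j)
  end.

Lemma form_valuesE w :
  form_values w = 0 + \sum_(t <- enum (free_index m n)) free_entry t w *: coef t.
Proof.
rewrite add0r big_enum /=; apply/rowP => p; rewrite summxE !mxE.
rewrite (biquadratic_free _ _ _ (gaussian_symmetric hA w)) mulr_sumr.
apply: eq_bigr => -[[[i j] k] l] _; rewrite !mxE /free_entry /=; ring.
Qed.

Lemma lse_measurable z (s : seq (tensor_index m n)) :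
  measurable_fun [set: T] (fun w => lse (z + \sum_(t <- s) free_entry t w *: coef t)).
Proof.
apply: measurableT_comp; first exact: measurable_ln.
apply: measurable_sum => p; apply: measurableT_comp; first exact: measurable_expR.
rewrite (_ : (fun w => _) = fun w => z ord0 p + \sum_(t <- s) free_entry t w * coef t ord0 p).
  apply: measurable_funD => //; apply: measurable_sum => t.
  by apply: measurable_funM => //; exact: free_entry_measurable.
apply/funext => w; rewrite mxE summxE; congr (_ + _); apply: eq_bigr => t _.
by rewrite mxE.
Qed.

Let idm t : (free_law t).-integrable [set: R] (EFin \o id).
Proof. exact: normal_scale_integrable_id (free_sigma_gt0 t). Qed.

Lemma form_values_integrable : P.-integrable [set: T] (EFin \o (lse \o form_values)).
Proof.
have := integrable_lip_sum P free_entry free_law free_entry_measurable coef lse 1 lse_lip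
  lse_measurable idm (enum (free_index m n)) 0 free_entry_law.
by under eq_fun do rewrite -form_valuesE.
Qed.

(** Passes from the probability space to iterated Gaussian integrals; the standard deviation of each
    free entry is absorbed into its direction. *)
Lemma expected_lse : \int[P]_w lse (form_values w) =
  gavgs [seq free_sigma t *: coef t | t <- enum (free_index m n)] lse 0.
Proof.
have := Rintegral_avgs P free_entry free_law free_entry_measurable coef lse 1 lse_lip
  lse_measurable idm (enum (free_index m n)) setT 0 (enum_uniq _) measurableT
  free_entry_law free_entry_indep.
rewrite [X in fine X]probability_setT mul1r => e.
transitivity (avgs free_law coef lse (enum (free_index m n)) 0).
  rewrite -e; apply: eq_Rintegral => w _; rewrite indicT mul1r.
  by rewrite form_valuesE.
have E (s : seq (tensor_index m n)) :
    avgs free_law coef lse s = gavgs [seq free_sigma t *: coef t | t <- s] lse.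
  elim: s => [|t s IH]; first by [].
  transitivity (avg (free_law t) (coef t) (avgs free_law coef lse s)); first by [].
  rewrite IH.
  exact: (avg_normal _ _ _ 1 (free_sigma_gt0 t) (gavgs_lip _ lse_lip)).
by rewrite E.
Qed.

Lemma increments_le p q :
  \sum_(c <- [seq free_sigma t *: coef t | t <- enum (free_index m n)])
    (c ord0 p - c ord0 q) ^+ 2 <=
  \sum_(b <- [seq comparison_coef a | a <- index_enum ('I_m + 'I_n)%type])
    (b ord0 p - b ord0 q) ^+ 2.
Proof.
rewrite !big_map big_enum /=.
have -> : \sum_(t in free_index m n) ((free_sigma t *: coef t) ord0 p - (free_sigma t *: coef t) ord0 q) ^+ 2 =
   beta ^+ 2 * (4 * (1 - dot (u p) (u q) ^+ 2 * dot (v p) (v q) ^+ 2)).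
  rewrite -rank_one_dist// mulr_sumr; apply: eq_bigr => t _.
  rewrite !mxE -mulrBr -mulrBr -mulrBr exprMn free_sigma_sqr.
  set N := #|_|%:R; have N0 : N != 0 by rewrite pnatr_eq0 -lt0n tensor_class_gt0.
  by field.
have -> : \sum_a (comparison_coef a ord0 p - comparison_coef a ord0 q) ^+ 2 =
    beta ^+ 2 * (4 * (2 * (1 - dot (u p) (u q)) + 2 * (1 - dot (v p) (v q)))).
  rewrite big_sumType /=.
  have -> : 2 * (1 - dot (u p) (u q)) = \sum_i (u p ord0 i - u q ord0 i) ^+ 2.
    by rewrite sum_sqrB//; ring.
  have -> : 2 * (1 - dot (v p) (v q)) = \sum_i (v p ord0 i - v q ord0 i) ^+ 2.
    by rewrite sum_sqrB//; ring.
  rewrite !mulrDr !mulr_sumr; congr (_ + _); apply: eq_bigr => a _; rewrite !mxE; ring.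
rewrite ler_wpM2l ?sqr_ge0// ler_wpM2l//.
by apply: sphere_increment_le; exact: dot_itv.
Qed.

(** Young's inequality 2 g.u <= |g|^2 / sqrt m + sqrt m |u|^2, and likewise for h, gives a quadratic
    majorant that does not depend on the point, to which [gavgs_quad_le] applies. *)
Lemma comparison_le :
  gavgs [seq comparison_coef a | a <- index_enum ('I_m + 'I_n)%type] lse 0 <=
  beta * (2 * Num.sqrt m%:R + 2 * Num.sqrt n%:R) + ln M.+1%:R.
Proof.
set sm := Num.sqrt m%:R; set sn := Num.sqrt n%:R.
have sm0 : 0 < sm by rewrite sqrtr_gt0 ltr0n.
have sn0 : 0 < sn by rewrite sqrtr_gt0 ltr0n.
have sm2 : sm ^+ 2 = m%:R by rewrite sqr_sqrtr.
have sn2 : sn ^+ 2 = n%:R by rewrite sqr_sqrtr.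
(* These weights sum to beta (sqrt m + sqrt n), as does the constant part obtained from |u| = |v| =
   1; the two halves make up the factor 2. *)
pose k (a : 'I_m + 'I_n) := if a is inl _ then beta / sm else beta / sn.
have k0 a : 0 <= k a by case: a => ?; rewrite /k divr_ge0// ltW.
have amgm (s x y : R) : 0 < s -> 2 * beta * (x * y) <= beta / s * x ^+ 2 + beta * s * y ^+ 2.
  move=> s0; rewrite -subr_ge0.
  have -> : beta / s * x ^+ 2 + beta * s * y ^+ 2 - 2 * beta * (x * y) =
      beta / s * (x - s * y) ^+ 2 by field; rewrite gt_eqF.
  by rewrite mulr_ge0 ?sqr_ge0// divr_ge0// ltW.
have H (x : 'I_m + 'I_n -> R) :
    lse (0 + \sum_(a <- index_enum ('I_m + 'I_n)%type) x a *: comparison_coef a) <=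
    (beta * (sm + sn) + ln M.+1%:R) + \sum_(a <- index_enum ('I_m + 'I_n)%type) k a * x a ^+ 2.
  rewrite add0r addrAC; apply: lse_le => p.
  rewrite summxE !big_sumType /=.
  have -> : beta * (sm + sn) =
      \sum_(i < m) beta * sm * u p ord0 i ^+ 2 + \sum_(j < n) beta * sn * v p ord0 j ^+ 2.
    by rewrite -!mulr_sumr !enorm_sqr_sum// !mulr1 mulrDr.
  rewrite addrACA -!big_split /=; apply: lerD; apply: ler_sum => a _; rewrite !mxE.
  - have := amgm sm (x (inl a)) (u p ord0 a) sm0; rewrite /k; lra.
  - have := amgm sn (x (inr a)) (v p ord0 a) sn0; rewrite /k; lra.
have := gavgs_quad_le _ (index_enum ('I_m + 'I_n)%type) comparison_coef k lse 1 lse_lip (index_enum_uniq _) k0 _ _ H.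
move/le_trans; apply; rewrite big_sumType /= !sumr_const !card_ord.
rewrite -(mulr_natr (beta / sm)) -(mulr_natr (beta / sn)) -sm2 -sn2.
have -> : beta / sm * sm ^+ 2 = beta * sm by field; rewrite gt_eqF.
have -> : beta / sn * sn ^+ 2 = beta * sn by field; rewrite gt_eqF.
lra.
Qed.

Lemma expected_lse_le : \int[P]_w lse (form_values w) <=
  beta * (2 * Num.sqrt m%:R + 2 * Num.sqrt n%:R) + ln M.+1%:R.
Proof.
rewrite expected_lse; apply: le_trans comparison_le.
exact: sudakov_fernique increments_le.
Qed.

End finite_points.

(** * Passage to the sphere *)

(* The integral is a difference of suprema over simple functions, hence monotone without
   measurability; this spares the measurability of [rho_m]. *)
Lemma le_integral_nonmeasurable {d : measure_display} {T : measurableType d} {R : realType}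
    (mu : {measure set T -> \bar R}) (f g : T -> \bar R) :
  (forall x, f x <= g x)%E -> (\int[mu]_x f x <= \int[mu]_x g x)%E.
Proof.
move=> fg; rewrite /integral !patch_setT; apply: leeB; apply: ereal_sup_le => _ [h /= hf <-];
  exists h => //= x; apply: le_trans (hf x) _.
  by rewrite !funeposE ge_max !le_max lexx orbT fg.
by rewrite !funenegE ge_max !le_max lexx orbT leeN2 fg.
Qed.

Lemma finite_net {R : realType} {V : normedModType R} (K : set V) (e : R) :
  compact K -> 0 < e ->
  exists s : seq V, (forall x, x \in s -> K x) /\
    forall x, K x -> exists2 y, y \in s & `|x - y| < e.
Proof.
rewrite compact_cover => cK e0.
have op (x : V) : K x -> open (ball x e) by move=> _; exact: ball_open.
have cv : K `<=` \bigcup_(x in K) ball x e.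
  by move=> x Kx; exists x => //; exact: ballxx.
have [D DK cov] := cK V K _ op cv.
exists (finmap.enum_fset D); split=> [x xD|x Kx].
  by have := DK x xD; rewrite inE.
have [y yD] := cov x Kx; rewrite -ball_normE /ball_/= => xy.
by exists y => //; rewrite distrC.
Qed.

Lemma coord_le1 {R : realType} {p : nat} (u : 'rV[R]_p) i :
  enorm u = 1 -> `|u ord0 i| <= 1.
Proof.
move=> u1; rewrite -u1 /enorm -sqrtr_sqr ler_wsqrtr// (bigD1 i)//= lerDl.
by apply: sumr_ge0 => j _; exact: sqr_ge0.
Qed.

Lemma prod_dist_le {R : realType} (a b c d x y : R) :
  `|a| <= 1 -> `|d| <= 1 -> `|b - d| <= x -> `|a - c| <= y ->
  `|a * b - c * d| <= x + y.
Proof.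
move=> a1 d1 bd ac.
have -> : a * b - c * d = a * (b - d) + (a - c) * d by ring.
apply: le_trans (ler_normD _ _) _; rewrite !normrM lerD//.
  by apply: le_trans bd; rewrite ler_piMl.
by apply: le_trans ac; rewrite ler_piMr.
Qed.

Lemma prod_norm_le1 {R : realType} (a b : R) : `|a| <= 1 -> `|b| <= 1 -> `|a * b| <= 1.
Proof. by move=> a1 b1; rewrite normrM mulr_ile1. Qed.

Lemma biquadratic_dist {R : realType} {m n : nat} (A : tensor R m n)
    (u u' : 'rV[R]_m) (v v' : 'rV[R]_n) (e : R) :
  enorm u = 1 -> enorm u' = 1 -> enorm v = 1 -> enorm v' = 1 ->
  `|u - u'| <= e -> `|v - v'| <= e ->
  `|biquadratic A u v - biquadratic A u' v'| <=
    4 * e * \sum_i \sum_k \sum_j \sum_l `|A i j k l|.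
Proof.
move=> u1 u1' v1 v1' du dv.
have cu i : `|u ord0 i - u' ord0 i| <= e.
  by apply: le_trans du; have := coord_le_mx_norm (u - u') ord0 i; rewrite !mxE.
have cv i : `|v ord0 i - v' ord0 i| <= e.
  by apply: le_trans dv; have := coord_le_mx_norm (v - v') ord0 i; rewrite !mxE.
rewrite !biquadraticE -sumrB mulr_sumr.
apply: le_trans (ler_norm_sum _ _ _) _; apply: ler_sum => i _.
rewrite -sumrB mulr_sumr; apply: le_trans (ler_norm_sum _ _ _) _; apply: ler_sum => k _.
rewrite -sumrB mulr_sumr; apply: le_trans (ler_norm_sum _ _ _) _; apply: ler_sum => j _.
rewrite -sumrB mulr_sumr; apply: le_trans (ler_norm_sum _ _ _) _; apply: ler_sum => l _.
rewrite -mulrBr normrM mulrC ler_wpM2r// /rank_one.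
(* One [e] for each factor of the product, replaced one at a time. *)
have -> : 4 * e = e + (e + (e + e)) by ring.
have U w i' : enorm w = 1 -> `|(w : 'rV[R]_m) ord0 i'| <= 1 by exact: coord_le1.
have W w i' : enorm w = 1 -> `|(w : 'rV[R]_n) ord0 i'| <= 1 by exact: coord_le1.
apply: prod_dist_le; rewrite ?prod_norm_le1 ?U ?W//.
apply: prod_dist_le; rewrite ?prod_norm_le1 ?U ?W//.
by apply: prod_dist_le; rewrite ?prod_norm_le1 ?U ?W.
Qed.

Theorem theorem2p3 (d : measure_display) (T : measurableType d) (R : realType)
    (P : probability T R) (m n : nat) (hm : (1 <= m)%N) (hn : (1 <= n)%N)
    (A : tensor {RV P >-> R} m n) (hA : gaussian_random_tensor A) :
  ('E_P[fun w => rho_m (fun i j k l => A i j k l w)] <=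
     (2 * Num.sqrt m%:R + 2 * Num.sqrt n%:R)%:E)%E.
Proof.
(* Up to the factor 4, a random Lipschitz constant of the form on the spheres, with finite
   expectation. *)
pose S w := \sum_i \sum_k \sum_j \sum_l `|A i j k l w|.
have iS : P.-integrable [set: T] (EFin \o S).
  do 4 (apply: integrable_sumr => ?).
  exact: (integrable_abse (free_entry_integrable P A hA (_, _, _, _))).
have S0 w : 0 <= S w by do 4 (apply: sumr_ge0 => ? _).
set C := \int[P]_w S w; have C0 : 0 <= C by exact: Rintegral_ge0.
apply/lee_addgt0Pr => e e0.
(* Makes 4 delta C at most e / 2; C may be 0, hence C + 1. *)
pose delta := e / (8 * (C + 1)).
have delta0 : 0 < delta by rewrite divr_gt0// mulr_gt0// ltr_wpDl.
have [su [suP suN]] := finite_net _ delta (@compact_sphere R m) delta0.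
have [sv [svP svN]] := finite_net _ delta (@compact_sphere R n) delta0.
have [u0 u0P] := @sphere_nonempty R m hm; have [v0 v0P] := @sphere_nonempty R n hn.
pose pts := [seq (x, y) | x <- su, y <- sv].
have [x0 x0s _] := suN u0 u0P; have [y0 y0s _] := svN v0 v0P.
have pts0 : (x0, y0) \in pts by exact: allpairs_f.
(* [lse] acts on vectors whose length is a successor; the net is nonempty, so its size is [M.+1]. *)
pose M := (size pts).-1.
have ME : M.+1 = size pts by rewrite prednK// lt0n size_eq0; apply: contraTneq pts0 => ->.
pose u (p : 'I_M.+1) := (nth (x0, y0) pts p).1.
pose v (p : 'I_M.+1) := (nth (x0, y0) pts p).2.
have ptsP (p : 'I_M.+1) : enorm (u p) = 1 /\ enorm (v p) = 1.
  have /allpairsP[q [q1 q2 e']] : nth (x0, y0) pts p \in pts.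
    by rewrite mem_nth// -ME.
  by rewrite /u /v e'; split; [exact: suP|exact: svP].
have u1 p := (ptsP p).1; have v1 p := (ptsP p).2.
have lnM : 0 <= ln M.+1%:R :> R by rewrite ln_ge0// ler1n.
(* Makes ln (M + 1) / beta at most e / 2; the added 1 keeps beta positive for a net of one point. *)
pose beta : R := 2 * (ln M.+1%:R + 1) / e.
have beta0 : 0 < beta by rewrite divr_gt0// mulr_gt0// ltr_wpDl.
(* An integrable majorant of [rho_m]: smooth maximum over the net plus discretization error. *)
pose h w := beta^-1 * lse (form_values P A u v beta w) + 4 * delta * S w.
have rho_le w : rho_m (fun i j k l => A i j k l w) <= h w.
  have [[uu [vv [uu1 vv1 ->]]] _] := rho_m_max (fun i j k l => A i j k l w) hm hn.
  have [x xs xd] := suN uu uu1; have [y ys yd] := svN vv vv1.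
  have xyp : (x, y) \in pts by exact: allpairs_f.
  have lt_p : (index (x, y) pts < M.+1)%N by rewrite ME index_mem.
  have := coord_le_lse (form_values P A u v beta w) (Ordinal lt_p).
  rewrite mxE /u /v /= nth_index// -ler_pdivlMl// => hp.
  have := biquadratic_dist (fun i j k l => A i j k l w) uu x vv y delta uu1 (suP x xs) vv1 (svP y ys) (ltW xd) (ltW yd).
  move/(le_trans (ler_norm _)); rewrite -/(S w) lerBlDl => /le_trans; apply.
  by rewrite /h lerD2r.
have if_ := form_values_integrable P A hA u v beta.
have ih1 := integrable_scaler beta^-1 if_; have ih2 := integrable_scaler (4 * delta) iS.
have ih : P.-integrable [set: T] (EFin \o h) := integrable_addr ih1 ih2.
rewrite unlock; apply: (@le_trans _ _ (\int[P]_w (h w)%:E)%E).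
  by apply: le_integral_nonmeasurable => w; rewrite lee_fin.
rewrite -(fineK (integrable_fin_num measurableT ih)) -EFinD lee_fin.
rewrite -[leLHS]/(\int[P]_w h w) RintegralD// !RintegralZl// -/C.
have main := expected_lse_le P A hA u v beta u1 v1 beta0 hm hn.
have {}main : beta^-1 * \int[P]_w lse (form_values P A u v beta w) <=
    2 * Num.sqrt m%:R + 2 * Num.sqrt n%:R + beta^-1 * ln M.+1%:R.
  by rewrite ler_pdivrMl// mulrDr mulVKf ?gt_eqF.
have b2 : beta^-1 * ln M.+1%:R <= e / 2.
  rewrite ler_pdivrMl// /beta.
  rewrite (_ : _ / e * (e / 2) = ln M.+1%:R + 1); last by field; rewrite gt_eqF.
  by rewrite lerDl.
have d2 : 4 * delta * C <= e / 2.
  rewrite /delta (_ : 4 * _ * C = (e / 2) * (C / (C + 1))); last by field; rewrite gt_eqF// ltr_wpDl.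
  apply: ler_piMr; first by rewrite divr_ge0// ltW.
  by rewrite ler_pdivrMr ?ltr_wpDl// mul1r lerDl.
lra.
Qed.
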